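(* Let $n\ge 3$ and let $W_n$ be the wheel graph with $n$ spokes. Then its genus polynomial is given (as an identity for real $x>0$, $\sqrt{x}$ denoting the positive square root) by $$\Gamma_{W_n}(x)=\frac{4}{n(n+1)}\sum_{m=0}^{\lfloor n/2\rfloor}\begin{bmatrix} n+1\\ n-2m\end{bmatrix}x^m+\frac{2(-1)^n}{n}\,x^{(n+1)/2}\sum_{k=0}^{n-1}c_k\left(k-n+1-\frac{1}{\sqrt{x}}\right)^{\overline{n}},$$ where $$c_0=2^{n-1}-1,\qquad c_k=\sum_{j=k+1}^{n-1-k}\binom{n-1}{j}\quad(1\le k\le n-2),\qquad c_{n-1}=-(2^{n-1}-1).$$ Here sums whose upper limit is less than the lower limit are read with the convention $\sum_{j=a}^{b}u_j=-\sum_{j=b+1}^{a-1}u_j$ when $b<a$ (so the sum is $0$ when $b=a-1$).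
   Context: The wheel graph $W_n$ ($n\ge3$) is obtained from the cycle $C_n$ by adding one new vertex and joining it to all vertices of $C_n$. Genus polynomial: surfaces are closed orientable; $\mathbb{S}_k$ is the orientable surface of genus $k$. An embedding of a connected graph $G$ on a surface $S$ is a homeomorphism $h$ of $G$ onto a subset $h(G)$ of $S$ such that every component of $S-h(G)$ is a 2-cell. Two embeddings $h,g:G\to S$ are equivalent if there is an orientation-preserving homeomorphism $f:S\to S$ with $f\circ h=g$. Let $g_k(G)$ be the number of equivalence classes of embeddings of $G$ on $\mathbb{S}_k$, and $\Gamma_G(x)=\sum_{k\ge0}g_k(G)x^k$. Equivalently (standard fact), $g_k(G)$ is the number of rotation systems of the labelled graph $G$ (a choice, at each vertex, of a cyclic permutation of the edge-ends at that vertex) whose face count $f$ obtained by face tracing satisfies $|V(G)|-|E(G)|+f=2-2k$. Notation: $\begin{bmatrix} n\\k\end{bmatrix}$ is the signless Stirling number of the first kind (number of permutations of $n$ elements with $k$ cycles), and $y^{\overline{n}}=y(y+1)\cdots(y+n-1)$ is the rising factorial. *)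

(* Defs.v *)
From mathcomp Require Import all_boot all_order all_fingroup all_algebra.
From mathcomp Require Import reals zify.

Set Implicit Arguments.
Unset Strict Implicit.
Unset Printing Implicit Defensive.

Import Order.TTheory GRing.Theory Num.Theory.
Local Open Scope ring_scope.

Record sgraph (V : finType) := SGraph {
  adj :> rel V;
  adj_sym : symmetric adj;
  adj_irr : irreflexive adj
}.

Section GenusPolynomial.
Variables (V : finType) (G : sgraph V).

Definition edges : {set {set V}} :=
  [set [set d.1; d.2] | d : V * V & G d.1 d.2].

(* The dart (u, v) is the end at u of the edge uv. *)
Definition dart := {d : V * V | G d.1 d.2}.

Definition tail (d : dart) : V := (val d).1.

Lemma dart_rev_subproof (d : dart) : G (val d).2 (val d).1.
Proof. by rewrite adj_sym (valP d). Qed.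

Definition dart_rev (d : dart) : dart :=
  exist (fun p : V * V => G p.1 p.2) ((val d).2, (val d).1)
        (dart_rev_subproof d).

Lemma dart_revK : involutive dart_rev.
Proof. by move=> [[u v] uv]; apply: val_inj. Qed.

Definition rev_perm : {perm dart} := perm (inv_inj dart_revK).

(* The cyclic permutations chosen at the individual vertices are packed into
   one permutation of the darts, whose cycles are exactly the sets of darts
   with a common tail. *)
Definition rotation_system (rho : {perm dart}) : bool :=
  [forall d, porbit rho d == [set d' | tail d' == tail d]].

(* Face tracing: d is followed by rho (dart_rev d).  (In an edgeless graph
   there are no darts to trace, hence no face is counted.) *)
Definition face_count (rho : {perm dart}) : nat :=
  #|porbits (rev_perm * rho)%g|.

(* Number of embeddings (up to equivalence) of a connected graph G with at
   least one edge on the orientable surface of genus k. *)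
Definition genus_count (k : nat) : nat :=
  #|[set rho : {perm dart} | rotation_system rho &
      #|V|%:Z - #|edges|%:Z + (face_count rho)%:Z == 2 - 2 * k%:Z]|.

(* The truncation is harmless: see coef_genus_poly. *)
Definition genus_poly (R : nzRingType) : {poly R} :=
  \poly_(k < #|edges|.+1) (genus_count k)%:R.

Lemma genus_count_eq0 (k : nat) : (0 < #|V|)%N ->
  (#|edges| < k)%N -> genus_count k = 0%N.
Proof.
move=> V0 ltk; apply: eq_card0 => rho; rewrite inE; apply/negbTE.
by rewrite negb_and; apply/orP; right; lia.
Qed.

Lemma coef_genus_poly (R : nzRingType) (k : nat) : (0 < #|V|)%N ->
  (genus_poly R)`_k = (genus_count k)%:R.
Proof.
move=> V0; rewrite coef_poly ltnS; case: leqP => // ltk.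
by rewrite genus_count_eq0.
Qed.

End GenusPolynomial.

Section Wheel.

Definition cycle_adj (n : nat) : rel 'I_n :=
  fun i j => (i != j) && ((j == ordS i) || (i == ordS j)).

Lemma cycle_adj_sym n : symmetric (@cycle_adj n).
Proof. by move=> i j; rewrite /cycle_adj eq_sym orbC. Qed.

Lemma cycle_adj_irr n : irreflexive (@cycle_adj n).
Proof. by move=> i; rewrite /cycle_adj eqxx. Qed.

(* This is the cycle C_n for n >= 3. *)
Definition cycle_graph (n : nat) : sgraph 'I_n :=
  SGraph (@cycle_adj_sym n) (@cycle_adj_irr n).

Variables (V : finType) (G : sgraph V).

Definition cone_adj : rel (option V) := fun u v =>
  match u, v with
  | Some x, Some y => G x y
  | None, None => false
  | _, _ => true
  end.

Lemma cone_adj_sym : symmetric cone_adj.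
Proof. by move=> [x|] [y|] //=; apply: adj_sym. Qed.

Lemma cone_adj_irr : irreflexive cone_adj.
Proof. by move=> [x|] //=; apply: adj_irr. Qed.

(* G with one new vertex None, joined to all vertices of G. *)
Definition cone : sgraph (option V) := SGraph cone_adj_sym cone_adj_irr.

End Wheel.

Definition wheel (n : nat) : sgraph (option 'I_n) := cone (cycle_graph n).

Definition stirling1 (n k : nat) : nat :=
  #|[set s : 'S_n | #|porbits s| == k]|.

Definition rising (R : pzRingType) (y : R) (n : nat) : R :=
  \prod_(i < n) (y + i%:R).

(* \sum_(a <= j <= b) u j, with the convention
   \sum_(j = a)^b u j = - \sum_(j = b + 1)^(a - 1) u j when b < a. *)
Definition signed_sum (a b : nat) (u : nat -> int) : int :=
  if (b < a)%N then - \sum_(b.+1 <= j < a) u j else \sum_(a <= j < b.+1) u j.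

(* Only meant for 0 <= k <= n - 1, where no subtraction on nat truncates. *)
Definition wheel_coef (n k : nat) : int :=
  if k == 0%N then 2 ^+ n.-1 - 1
  else if k == n.-1 then - (2 ^+ n.-1 - 1)
  else signed_sum k.+1 (n.-1 - k) (fun j => 'C(n.-1, j)%:Z).

(* Main.v *)
Require Import Defs.
From HB Require Import structures.
From mathcomp Require Import all_boot all_order all_fingroup all_algebra.
From mathcomp Require Import reals ring zify.

Set Implicit Arguments.
Unset Strict Implicit.
Unset Printing Implicit Defensive.

Import Order.TTheory GRing.Theory Num.Theory.
Local Open Scope ring_scope.

(** At a rim vertex of the wheel, each of the two rotations puts the spoke on
    one side of the rim; a rotation system is therefore a set A of spokes (those
    on the inner side, say) together with a cyclic permutation s of the n spokes
    at the hub.  Following a face out of the hub along spoke i, one walks along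
    the rim to the next spoke on the same side and returns to the hub there.  If
    rim A denotes the permutation doing that (it runs through A in increasing
    and through its complement in decreasing order), the faces that visit the
    hub are the cycles of rim A * s; one more face, which avoids the hub,
    appears exactly when all the spokes lie on the same side
    ([face_count_proper], [face_count_trivial]).  Everything thus reduces to the
    polynomials F(tau)(y), the sum of y ^ (number of cycles of tau * s) over all
    n-cycles s, for tau with one or two cycles.

    The main ingredient ([cycle_sum_rchar]) evaluates them for every tau of n
    points:
       n (n + 1) F(tau)(y) = (det (1 - E P_tau)) (y (y + 1) ... (y + n)),
    where P_tau is the permutation matrix and E the backward shift
    f(y) |-> f(y - 1).  It is proved by induction on n, inserting a new point 0
    into the cycles of both tau and s.  If 0 is fixed by tau the sum is
    multiplied by the number of other points; if it comes after p in a cycle of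
    tau, then
       F(tau) = y F(tau') + sum over i <> p of F(tau' with i and p exchanged),
    tau' being tau without 0.  The determinants obey a matching recurrence,
    because exchanging i and p or inserting 0 is a perturbation of 1 - X P by a
    matrix of rank one: everything can be written in terms of the adjugate of
    1 - X P, whose rows and columns have known sums (all rows and columns of P
    sum to 1) and whose trace is given by the derivative of the determinant.

    For tau = rim A the determinant is 1 - X^n, or (1 - X^a) (1 - X^(n - a)) with
    a = #|A|.  The first kind gives a telescoping difference of two rising
    factorials, which expands into Stirling numbers; summing the second kind
    over A gives 2^n (1 + X^n) - 2 (1 + X)^n, and dividing it by 1 - X produces
    the coefficients c_k.  A parity argument (signs of permutations) shows that
    every face count is compatible with Euler's formula, so that the genus
    polynomial at x is the sum over all rotation systems of
    sqrt(x) ^ (n + 1 - face count). *)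

Local Notation ncyc s := #|porbits s|.

(** * Counting cycles of permutations *)

Lemma porbit_step (T : finType) (s : {perm T}) x : s x \in porbit s x.
Proof. by have := mem_porbit s 1 x; rewrite expg1. Qed.

Lemma porbit_homo (T I : finType) (phi : {perm T}) (psi : {perm I})
    (p : T -> I) :
    (forall d, p (phi d) \in porbit psi (p d)) ->
  forall d d', d' \in porbit phi d -> p d' \in porbit psi (p d).
Proof.
move=> step d d' /porbitP[k ->]; elim: k => [|k IHk].
  by rewrite expg0 perm1 porbit_id.
rewrite expgSr permM; move: IHk; rewrite -!eq_porbit_mem => /eqP <-.
by rewrite eq_porbit_mem step.
Qed.

Lemma leq_card_porbits (T I : finType) (phi : {perm T}) (psi : {perm I})
    (h : I -> T) (p : T -> I) :
    (forall i, h (psi i) \in porbit phi (h i)) ->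
    (forall d, h (p d) \in porbit phi d) ->
  (ncyc phi <= ncyc psi)%N.
Proof.
move=> h_homo hp; pose rep (O : {set I}) := [pick i in O].
pose G O := if rep O is Some i then porbit phi (h i) else set0.
apply: (leq_trans (subset_leq_card _) (leq_imset_card G _)).
apply/subsetP=> O /imsetP[d _ ->]; apply/imsetP.
exists (porbit psi (p d)); first exact: imset_f.
rewrite /G /rep; case: pickP => [i /(porbit_homo h_homo) hi | /(_ (p d))].
  apply/eqP; rewrite eq_porbit_mem porbit_sym -eq_porbit_mem.
  by move: hi (hp d); rewrite -!eq_porbit_mem => /eqP -> /eqP ->.
by rewrite porbit_id.
Qed.

(** A pair of maps that are mutually inverse up to orbits, and respect orbits,
    identifies the two sets of cycles.  With p sending a point to the next
    visited point of a subset h, this compares a permutation with the one it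
    induces on that subset. *)
Lemma card_porbits_transfer (T I : finType) (phi : {perm T}) (psi : {perm I})
    (h : I -> T) (p : T -> I) :
    (forall d, p (phi d) \in porbit psi (p d)) ->
    (forall i, h (psi i) \in porbit phi (h i)) ->
    (forall d, h (p d) \in porbit phi d) ->
    (forall i, p (h i) \in porbit psi i) ->
  ncyc phi = ncyc psi.
Proof.
move=> pP hP hp ph; apply/eqP; rewrite eqn_leq.
by rewrite (leq_card_porbits hP hp) (leq_card_porbits pP ph).
Qed.

Lemma card_porbits_mulC (T : finType) (s t : {perm T}) :
  ncyc (s * t)%g = ncyc (t * s)%g.
Proof.
apply: (@card_porbits_transfer _ _ _ _ t s) => d;
  by rewrite -?permM ?mulgA ?porbit_step // -mulgA permM porbit_step.
Qed.

Lemma porbits_gt0 n (s : 'S_n.+1) : (0 < ncyc s)%N.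
Proof. by rewrite card_gt0; apply/set0Pn; exists (porbit s 0); exact: imset_f. Qed.

Lemma lift0_permM n (s t : 'S_n) :
  lift0_perm (s * t)%g = (lift0_perm s * lift0_perm t)%g.
Proof. by rewrite /lift0_perm (lift_permM 0 0 0). Qed.

Lemma lift0_permV n (s : 'S_n) : lift0_perm s^-1%g = (lift0_perm s)^-1%g.
Proof. by rewrite /lift0_perm lift_permV. Qed.

Lemma lift0_tperm n (i j : 'I_n) :
  lift0_perm (tperm i j) = tperm (lift 0 i) (lift 0 j).
Proof.
apply/permP=> x; case: (unliftP 0 x) => [k|] ->.
  by rewrite lift0_perm_lift (inj_tperm _ _ _ (@lift_inj _ 0)).
by rewrite lift0_perm0 tpermD // eq_sym neq_lift.
Qed.

Lemma lift0_permX n (s : 'S_n) k : lift0_perm (s ^+ k)%g = (lift0_perm s ^+ k)%g.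
Proof.
elim: k => [|k IHk]; first by rewrite !expg0 /lift0_perm lift_perm1.
by rewrite !expgS lift0_permM IHk.
Qed.

Lemma porbit_lift0 n (s : 'S_n) i :
  porbit (lift0_perm s) (lift 0 i) = lift 0 @: porbit s i.
Proof.
apply/setP=> y; apply/porbitP/imsetP => [[k ->]|[j /porbitP[k ->] ->]].
  by exists ((s ^+ k)%g i); rewrite ?mem_porbit // -lift0_permX lift0_perm_lift.
by exists k; rewrite -lift0_permX lift0_perm_lift.
Qed.

Lemma porbit_lift0_0 n (s : 'S_n) : porbit (lift0_perm s) 0 = [set 0].
Proof.
apply/setP=> y; rewrite inE; apply/porbitP/eqP => [[k ->]|->].
  by rewrite -lift0_permX lift0_perm0.
by exists 0; rewrite expg0 perm1.
Qed.

Lemma card_porbits_lift0 n (s : 'S_n) : ncyc (lift0_perm s) = (ncyc s).+1.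
Proof.
pose L := imset (lift (0 : 'I_n.+1)).
have -> : porbits (lift0_perm s) =
    [set 0] |: [set lift 0 @: (O : {set _}) | O in porbits s].
  apply/setP=> O; rewrite inE in_set1; apply/imsetP/orP => [[y _ ->]|].
    case: (unliftP 0 y) => [j|] ->; last by left; rewrite porbit_lift0_0.
    by right; rewrite porbit_lift0; apply/imset_f/imset_f.
  case=> [/eqP ->|/imsetP[_ /imsetP[i _ ->] ->]].
    by exists 0; rewrite ?porbit_lift0_0.
  by exists (lift 0 i); rewrite ?porbit_lift0.
rewrite cardsU1 card_imset; last exact/imset_inj/lift_inj.
suff -> : [set 0] \notin [set lift 0 @: (O : {set _}) | O in porbits s] by [].
apply/imsetP=> -[O _ /setP/(_ 0)]; rewrite set11 => /esym/imsetP[j _ /eqP].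
by rewrite (negPf (neq_lift _ _)).
Qed.

Lemma card_porbits_tperm_lift0 n (s : 'S_n) i :
  ncyc (tperm 0 (lift 0 i) * lift0_perm s)%g = ncyc s.
Proof.
have /= := porbits_mul_tperm (lift0_perm s) 0 (lift 0 i).
rewrite card_porbits_lift0 porbit_sym porbit_lift0_0 in_set1 eq_sym eq_liftF /=.
by rewrite addn2 addn1 => -[].
Qed.

(** Every permutation of n + 1 points arises exactly once from a permutation of
    the points other than 0 by inserting 0 in a cycle, just after the point j, or
    as a new cycle when j = 0. *)
Definition insert0 n (js : 'I_n.+1 * 'S_n) : 'S_n.+1 :=
  (tperm 0 js.1 * lift0_perm js.2)%g.

Lemma insert0_bij n : bijective (@insert0 n).
Proof.
apply: inj_card_bij.
  move=> [j s] [j' s']; rewrite /insert0 /= => eqs.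
  have jj' : j = j'.
    apply: (@perm_inj _ (tperm 0 j * lift0_perm s)%g).
    by rewrite {2}eqs !permM !tpermR !lift0_perm0.
  congr pair => //; move: eqs; rewrite jj' => /mulgI eqs.
  apply/permP=> i; apply: (@lift_inj _ 0).
  by rewrite -!lift0_perm_lift eqs.
by rewrite card_prod card_ord !card_Sn factS.
Qed.

Lemma insert0P n (s : 'S_n.+1) :
  exists j, exists t : 'S_n, s = (tperm 0 j * lift0_perm t)%g.
Proof.
case: (insert0_bij n) => [g _ gK]; exists (g s).1, (g s).2.
by rewrite -[LHS]gK.
Qed.

Lemma sum_insert0 (V : nmodType) n (G : 'S_n.+1 -> V) :
  \sum_s G s = \sum_s (G (lift0_perm s) +
     \sum_i G (tperm 0 (lift 0 i) * lift0_perm s)%g).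
Proof.
rewrite (reindex (@insert0 n)); last exact/onW_bij/insert0_bij.
rewrite -(pair_bigA _ (fun j s => G (insert0 (j, s)))) /= exchange_big /=.
apply: eq_bigr => s _; rewrite big_ord_recl /insert0 /=.
by rewrite tperm1 mul1g.
Qed.

Lemma risingSr (R : comPzRingType) (y : R) n : rising y n.+1 = rising y n * (y + n%:R).
Proof. by rewrite /rising big_ord_recr. Qed.

Lemma risingSl (R : comPzRingType) (y : R) n : rising y n.+1 = y * rising (y + 1) n.
Proof.
rewrite /rising big_ord_recl addr0; congr (_ * _); apply: eq_bigr => i _.
by rewrite lift0 -natr1; ring.
Qed.

Lemma sum_perm_cycles (R : comPzRingType) (y : R) n :
  \sum_(s : 'S_n) y ^+ ncyc s = rising y n.
Proof.
elim: n => [|n IHn].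
  rewrite /rising big_ord0 (big_pred1 1%g) => [|s]; last first.
    by apply/esym/eqP/permP; case.
  rewrite (_ : porbits _ = set0) ?cards0 //; apply/setP=> O.
  by rewrite inE; apply/imsetP=> -[[]].
rewrite sum_insert0 risingSr -IHn mulr_suml; apply: eq_bigr => s _.
rewrite card_porbits_lift0 exprS (eq_bigr (fun=> y ^+ ncyc s)) => [|i _]; last first.
  by rewrite card_porbits_tperm_lift0.
by rewrite sumr_const card_ord -(mulr_natl (_ ^+ _)) -mulrDl mulrC.
Qed.

Lemma sum_stirling1 (R : comPzRingType) (y : R) n :
  \sum_(k < n.+1) (stirling1 n k)%:R * y ^+ k = rising y n.
Proof.
rewrite -sum_perm_cycles.
have cyc_le (s : 'S_n) : (ncyc s < n.+1)%N.
  by rewrite ltnS (leq_trans (leq_imset_card _ _)) // card_ord.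
rewrite (partition_big (fun s : 'S_n => Ordinal (cyc_le s)) predT) //=.
apply: eq_bigr => k _; rewrite (eq_bigr (fun=> y ^+ k)); last first.
  by move=> s /eqP <-.
rewrite sumr_const mulr_natl /stirling1; congr (_ *+ _).
by apply: eq_card => s; rewrite !inE.
Qed.

Definition cycle_sum (R : nzRingType) (y : R) n (tau : 'S_n) : R :=
  \sum_(s : 'S_n | ncyc s == 1%N) y ^+ ncyc (tau * s)%g.

Lemma cycle_sum1 (R : comNzRingType) (y : R) (tau : 'S_1) : cycle_sum y tau = y.
Proof.
have c1 (s : 'S_1) : ncyc s = 1%N.
  apply/eqP; rewrite eqn_leq porbits_gt0.
  by rewrite (leq_trans (leq_imset_card _ _)) ?card_ord.
rewrite /cycle_sum (eq_bigl predT) => [|s]; last by rewrite c1.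
by rewrite (eq_bigr (fun=> y)) => [|s _]; rewrite ?c1 // sumr_const card_Sn.
Qed.


(** The mirror image of [sum_insert0].  In [cycle_sum_insert0], tau carries its
    transposition on the left and s on the right, so that conjugation brings the
    two transpositions next to each other. *)
Lemma sum_insert0V (V : nmodType) n (G : 'S_n.+1 -> V) :
  \sum_s G s = \sum_s (G (lift0_perm s) +
     \sum_i G (lift0_perm s * tperm 0 (lift 0 i))%g).
Proof.
rewrite (reindex_inj invg_inj) sum_insert0 (reindex_inj invg_inj) /=.
apply: eq_bigr => s _; rewrite lift0_permV invgK.
congr (_ + _); apply: eq_bigr => i _; congr G.
by rewrite invMg tpermV invgK.
Qed.

Lemma cycle_sum_rec (R : comNzRingType) (y : R) n (tau : 'S_n.+2) :
  cycle_sum y tau =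
  \sum_(s : 'S_n.+1 | ncyc s == 1%N)
     \sum_i y ^+ ncyc (tau * (lift0_perm s * tperm 0 (lift 0 i)))%g.
Proof.
rewrite /cycle_sum big_mkcond sum_insert0V [RHS]big_mkcond /=.
apply: eq_bigr => s _; rewrite card_porbits_lift0 eqSS eqn0Ngt porbits_gt0 add0r.
case: ifP => cs; last rewrite big1 // => i _;
  last by rewrite card_porbits_mulC card_porbits_tperm_lift0 cs.
by apply: eq_bigr => i _; rewrite card_porbits_mulC card_porbits_tperm_lift0 cs.
Qed.

(** Wherever 0 is inserted in s, it joins a cycle of tau * s when tau fixes it. *)
Lemma cycle_sum_lift0 (R : comNzRingType) (y : R) n (tau : 'S_n.+1) :
  cycle_sum y (lift0_perm tau) = n.+1%:R * cycle_sum y tau.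
Proof.
rewrite cycle_sum_rec mulr_sumr; apply: eq_bigr => s _.
rewrite (eq_bigr (fun=> y ^+ ncyc (tau * s)%g)) ?sumr_const ?card_ord ?mulr_natl //.
move=> i _; rewrite mulgA -lift0_permM [in LHS]card_porbits_mulC.
by rewrite card_porbits_tperm_lift0.
Qed.

(** When 0 is inserted in s at the same place as in tau, it becomes a cycle of
    its own in tau * s, whence the factor y; inserted elsewhere, its removal
    leaves a transposition of the two places. *)
Lemma cycle_sum_insert0 (R : comNzRingType) (y : R) n (tau : 'S_n.+1) (p : 'I_n.+1) :
  cycle_sum y (tperm 0 (lift 0 p) * lift0_perm tau)%g =
  y * cycle_sum y tau + \sum_(i | i != p) cycle_sum y (tperm i p * tau)%g.
Proof.
rewrite cycle_sum_rec exchange_big (bigD1 p) //=; congr (_ + _).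
  rewrite mulr_sumr; apply: eq_bigr => s _.
  rewrite mulgA [in LHS]card_porbits_mulC !mulgA tperm2 mul1g.
  by rewrite -lift0_permM card_porbits_lift0 exprS.
apply: eq_bigr => i ip; apply: eq_bigr => s _; congr (_ ^+ _).
rewrite mulgA [in LHS]card_porbits_mulC !mulgA.
rewrite (conjgC (tperm 0 (lift 0 i))) tpermJ tpermL tpermD ?neq_lift //; last first.
  by rewrite (inj_eq lift_inj) eq_sym.
rewrite (tpermC (lift 0 p)) -lift0_tperm -!mulgA -!lift0_permM card_porbits_tperm_lift0.
by rewrite !mulgA.
Qed.

(** * The reversed characteristic polynomial of a permutation *)

Definition setrow (R : Type) n (A : 'M[R]_n) i (r : 'rV[R]_n) : 'M[R]_n :=
  \matrix_(k, j) if k == i then r 0 j else A k j.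

Lemma det_setrow (R : comPzRingType) n (A : 'M[R]_n) i r :
  \det (setrow A i r) = (r *m \adj A) 0 i.
Proof.
rewrite (expand_det_row _ i) mxE; apply: eq_bigr => j _.
rewrite [in RHS]mxE /cofactor mxE eqxx; congr (_ * (_ * \det _)).
by apply/matrixP=> a b; rewrite !mxE eq_sym (negPf (neq_lift _ _)).
Qed.

Lemma det_add_row (R : comPzRingType) n (A : 'M[R]_n) i (r : 'rV_n) :
  \det (A + delta_mx i (0 : 'I_1) *m r) = \det A + (r *m \adj A) 0 i.
Proof.
rewrite -det_setrow -[\det A]mul1r -[\det (setrow _ _ _)]mul1r.
apply: (determinant_multilinear (i0 := i)).
- apply/rowP=> j; rewrite !mxE eqxx big_ord1 !mxE !eqxx /=; ring.
- apply/matrixP=> k j; rewrite !mxE big_ord1 !mxE [_ == i]eq_sym.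
  by rewrite (negPf (neq_lift _ _)) mul0r addr0.
apply/matrixP=> k j; rewrite !mxE big_ord1 !mxE [_ == i]eq_sym.
by rewrite (negPf (neq_lift _ _)) mul0r addr0.
Qed.

(** The matrix determinant lemma for a column with two nonzero entries.  After
    w has been added to row i, replacing row p by w still gives the minor of A:
    the extra contribution has w in both rows. *)
Lemma det_sub_rows (R : comPzRingType) n (A : 'M[R]_n) i p (w : 'rV_n) : i != p ->
  \det (A + (delta_mx i (0 : 'I_1) - delta_mx p 0) *m w) =
  \det A + (w *m \adj A) 0 i - (w *m \adj A) 0 p.
Proof.
move=> ip; rewrite mulmxBl addrA -mulmxN det_add_row det_add_row.
congr (_ + _); rewrite mulNmx mxE; congr (- _); rewrite -!det_setrow.
set B := setrow _ p w; set C := setrow _ p w.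
have -> : \det B = 1 * \det C + 1 * \det (setrow C i w).
  apply: (determinant_multilinear (i0 := i)).
  - by apply/rowP=> j; rewrite !mxE eqxx (negPf ip) big_ord1 !mxE !eqxx /=; ring.
  - apply/matrixP=> k j; rewrite !mxE big_ord1 !mxE; case: ifP => // _.
    by rewrite [_ == i]eq_sym (negPf (neq_lift _ _)) mul0r addr0.
  apply/matrixP=> k j; rewrite !mxE big_ord1 !mxE [_ == i]eq_sym.
  by rewrite (negPf (neq_lift _ _)) mul0r addr0.
rewrite (_ : \det (setrow C i w) = 0) ?mulr0 ?addr0 ?mul1r //.
apply: (determinant_alternate ip) => j; rewrite !mxE !eqxx.
by case: ifP.
Qed.

Lemma deriv_prod_ord (R : comNzRingType) n (F : 'I_n -> {poly R}) :
  (\prod_i F i)^`() = \sum_i \prod_j (if j == i then (F j)^`() else F j).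
Proof.
elim: n F => [|n IHn] F; first by rewrite !big_ord0 -polyC1 derivC.
rewrite !big_ord_recl derivM IHn mulr_sumr; congr (_ + _).
by apply: eq_bigr => i _; rewrite big_ord_recl /=.
Qed.

Lemma deriv_det (R : comNzRingType) n (A : 'M[{poly R}]_n) :
  (\det A)^`() = \sum_i \det (setrow A i (map_mx (@deriv R) (row i A))).
Proof.
rewrite /determinant linear_sum [RHS]exchange_big /=; apply: eq_bigr => s _.
rewrite -mulr_sumr mulr_sign [in RHS]mulr_sign.
have <- : (\prod_i A i (s i))^`() =
    \sum_i \prod_j setrow A i (map_mx (@deriv R) (row i A)) j (s j).
  rewrite deriv_prod_ord.
  apply: eq_bigr => i _; apply: eq_bigr => j _; rewrite !mxE.
  by case: eqP => [->|].
by case: ifP; rewrite ?derivN.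
Qed.

Section PermDet.
Variable R : comNzRingType.

(** [resolvent s] is 1 - X P; its determinant is the product of 1 - X^c over the
    lengths c of the cycles of s. *)
Definition resolvent n (s : 'S_n) : 'M[{poly R}]_n := 1%:M - 'X *: perm_mx s.
Definition rchar n (s : 'S_n) : {poly R} := \det (resolvent s).

Local Notation adjr s := (\adj (resolvent s)).

(** X P = 1 - (1 - X P), and 1 - X P times its adjugate is a scalar matrix. *)
Lemma row_perm_adj n (s : 'S_n) i k :
  (('X *: row i (perm_mx s)) *m adjr s) 0 k = adjr s i k - rchar s *+ (i == k).
Proof.
have -> : 'X *: row i (perm_mx s) = row i (1%:M - resolvent s).
  by rewrite /resolvent opprB addrC subrK linearZ.
by rewrite -row_mul mulmxBl mul1mx mul_mx_adj !mxE.
Qed.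

(** Exchanging two rows of P adds to 1 - X P the matrix d *m w of rank one, where
    d = e_i - e_p and w = X (P_i - P_p). *)
Lemma rchar_tperm n (s : 'S_n) i p : i != p ->
  rchar (tperm i p * s)%g =
  - rchar s + adjr s i i + adjr s p p - adjr s i p - adjr s p i.
Proof.
move=> ip; pose w := 'X *: row i (perm_mx s) - 'X *: row p (perm_mx s) : 'rV[{poly R}]_n.
rewrite /rchar.
have -> : resolvent (tperm i p * s)%g =
    resolvent s + (delta_mx i (0 : 'I_1) - delta_mx p 0) *m w.
  apply/matrixP=> a b; rewrite !mxE big_ord1 !mxE !eqxx !andbT permM.
  have [->|ai] := eqVneq a i; first by rewrite tpermL (negPf ip) /=; ring.
  have [->|ap] := eqVneq a p; first by rewrite tpermR /=; ring.
  by rewrite tpermD 1?eq_sym //=; ring.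
have wE k : (w *m adjr s) 0 k =
    adjr s i k - rchar s *+ (i == k) - (adjr s p k - rchar s *+ (p == k)).
  by rewrite mulmxBl mxE [X in _ + X]mxE !row_perm_adj.
rewrite det_sub_rows // !wE.
rewrite !eqxx (negPf ip) eq_sym (negPf ip) -/(rchar s) /=.
by rewrite mulr0n !mulr1n; ring.
Qed.

(** The constant column is an eigenvector of 1 - X P for the eigenvalue 1 - X. *)
Lemma sum_adj_row n (s : 'S_n) p : (1 - 'X) * \sum_j adjr s p j = rchar s.
Proof.
have e : (1 - 'X) *: (adjr s *m (const_mx 1 : 'cV_n)) = rchar s *: const_mx 1.
  rewrite -[RHS]mul_scalar_mx -mul_adj_mx -mulmxA scalemxAr; congr (_ *m _).
  by rewrite mulmxBl mul1mx -scalemxAl -row_permE row_perm_const scalerBl scale1r.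
transitivity (((1 - 'X) *: (adjr s *m (const_mx 1 : 'cV_n))) p 0).
  rewrite [RHS]mxE [in RHS]mxE; congr (_ * _); apply: eq_bigr => j _.
  by rewrite [const_mx _ _ _]mxE mulr1.
by rewrite e !mxE mulr1.
Qed.

Lemma sum_adj_col n (s : 'S_n) p : (1 - 'X) * \sum_j adjr s j p = rchar s.
Proof.
have e : (1 - 'X) *: ((const_mx 1 : 'rV_n) *m adjr s) = rchar s *: const_mx 1.
  rewrite -[RHS]mul_mx_scalar -mul_mx_adj mulmxA scalemxAl; congr (_ *m _).
  rewrite mulmxBr mulmx1 -scalemxAr -[s]invgK -col_permE col_perm_const.
  by rewrite scalerBl scale1r.
transitivity (((1 - 'X) *: ((const_mx 1 : 'rV_n) *m adjr s)) 0 p).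
  rewrite [RHS]mxE [in RHS]mxE; congr (_ * _); apply: eq_bigr => j _.
  by rewrite [const_mx _ _ _]mxE mul1r.
by rewrite e !mxE mulr1.
Qed.

(** Differentiating the determinant row by row replaces row i by - P_i, and
    - X P_i is row i of (1 - X P) - 1. *)
Lemma mxtrace_adj n (s : 'S_n) : \tr (adjr s) = n%:R * rchar s - 'X * (rchar s)^`().
Proof.
rewrite deriv_det [X in _ = _ - X]mulr_sumr /mxtrace.
rewrite (eq_bigr (fun i => rchar s - 'X *
  \det (setrow (resolvent s) i (map_mx (@deriv R) (row i (resolvent s)))))).
  by rewrite sumrB sumr_const card_ord mulr_natl.
move=> i _; rewrite det_setrow.
have -> : map_mx (@deriv R) (row i (resolvent s)) = - row i (perm_mx s).
  apply/rowP=> j; rewrite !mxE derivB derivMn derivM derivX mul1r.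
  by rewrite -polyC1 derivC mul0rn derivMn derivC mul0rn mulr0 addr0 sub0r.
have -> : forall c : {poly R}, c - 'X * (- row i (perm_mx s) *m adjr s) 0 i =
   c + (('X *: row i (perm_mx s)) *m adjr s) 0 i.
  by move=> c; rewrite mulNmx -scalemxAl !mxE mulrN opprK.
by rewrite row_perm_adj eqxx mulr1n addrC subrK.
Qed.

(** The sum that matches the one in [cycle_sum_insert0]; the factor 1 - X clears
    the denominators of the row and column sums of the adjugate. *)
Lemma sum_rchar_tperm n (s : 'S_n.+1) p :
  (1 - 'X) * \sum_(i | i != p) rchar (tperm i p * s)%g =
  (1 - 'X) * (rchar s + n.+1%:R * adjr s p p - 'X * (rchar s)^`()) - 2 * rchar s.
Proof.
pose G i := - rchar s + adjr s i i + adjr s p p - adjr s i p - adjr s p i.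
have -> : \sum_(i | i != p) rchar (tperm i p * s)%g = \sum_i G i + rchar s.
  rewrite [in RHS](bigD1 p) //= addrAC (_ : G p + _ = 0) ?add0r.
    by apply: eq_bigr => i ip; rewrite rchar_tperm.
  by rewrite /G; ring.
have -> : \sum_i G i = n.+1%:R * (adjr s p p - rchar s) + \tr (adjr s)
    - \sum_i adjr s i p - \sum_i adjr s p i.
  rewrite /G !sumrB !big_split /= !sumr_const card_ord mulr_natl mulrnBl /mxtrace.
  by rewrite mulNrn; ring.
rewrite mxtrace_adj.
have := sum_adj_col s p; have := sum_adj_row s p.
set a := \sum_j adjr s p j; set b := \sum_j adjr s j p; set c := adjr s p p.
set d := (_)^`(); set g := rchar s => ag bg.
transitivity ((1 - 'X) * (g + n.+1%:R * c - 'X * d) - ((1 - 'X) * a + (1 - 'X) * b)).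
  by ring.
by rewrite ag bg; ring.
Qed.

Lemma resolvent_lift0 n (s : 'S_n) :
  resolvent (lift0_perm s) = block_mx (1 - 'X)%:M 0 0 (resolvent s) :> 'M_(1 + n).
Proof.
transitivity ((1%:M : 'M[{poly R}]_(1 + n)) - 'X *: block_mx 1 0 0 (perm_mx s)).
  by rewrite /resolvent -lift0_mx_perm.
rewrite scale_block_mx scalar_mx_block.
rewrite opp_block_mx add_block_mx !scaler0 !subr0; congr block_mx.
by apply/matrixP=> i j; rewrite !ord1 !mxE !eqxx mulr1.
Qed.

Lemma rchar_lift0 n (s : 'S_n) : rchar (lift0_perm s) = (1 - 'X) * rchar s.
Proof.
transitivity (\det (block_mx (1 - 'X)%:M 0 0 (resolvent s) : 'M_(1 + n))).
  by rewrite /rchar resolvent_lift0.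
by rewrite det_ublock det_scalar1.
Qed.

Lemma rchar_at0 n (s : 'S_n) : (rchar s).[0] = 1.
Proof.
rewrite /rchar -[_.[0]]/(horner_eval 0 _) -det_map_mx.
rewrite (_ : map_mx _ _ = 1%:M) ?det1 //; apply/matrixP=> i j.
by rewrite !mxE rmorphB rmorphM !rmorph_nat /= /horner_eval hornerX mul0r subr0.
Qed.

Lemma rchar_neq0 n (s : 'S_n) : rchar s != 0.
Proof.
by apply/eqP=> s0; have := rchar_at0 s; rewrite s0 horner0 => /esym/eqP; rewrite oner_eq0.
Qed.

End PermDet.

Lemma adj_unique (R : idomainType) n (A B : 'M[R]_n) :
  \det A != 0 -> A *m B = (\det A)%:M -> B = \adj A.
Proof.
move=> A0 AB.
have : \det A *: B = \det A *: \adj A.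
  by rewrite -mul_scalar_mx -mul_adj_mx -mulmxA AB mul_mx_scalar.
move: (\adj A) => C /matrixP e; apply/matrixP=> i j; apply: (mulfI A0).
by move: (e i j); rewrite !mxE.
Qed.

(** Apply [rchar_tperm] to the permutation that fixes 0, whose matrix is block
    diagonal and therefore has a block diagonal adjugate. *)
Lemma rchar_insert0 (R : idomainType) n (s : 'S_n.+1) (p : 'I_n.+1) :
  rchar R (tperm 0 (lift 0 p) * lift0_perm s)%g =
  (1 - 'X) * \adj (resolvent R s) p p + 'X * rchar R s.
Proof.
rewrite rchar_tperm ?neq_lift // rchar_lift0.
pose B : 'M_(1 + n.+1) := block_mx (rchar R s)%:M 0 0 ((1 - 'X) *: \adj (resolvent R s)).
have adjB : \adj (block_mx (1 - 'X)%:M 0 0 (resolvent R s) : 'M_(1 + n.+1)) = B.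
  apply/esym/adj_unique; rewrite det_ublock det_scalar1 -/(rchar R s).
    by rewrite -rchar_lift0 rchar_neq0.
  rewrite mulmx_block !mulmx0 !mul0mx !addr0 add0r.
  rewrite -scalemxAr mul_mx_adj [RHS]scalar_mx_block -scalar_mxM; congr block_mx.
  by rewrite scale_scalar_mx.
have -> : \adj (resolvent R (lift0_perm s)) = B by rewrite resolvent_lift0.
have -> : lift 0 p = rshift 1 p :> 'I_(1 + n.+1) by apply: val_inj.
have -> : 0 = lshift n.+1 0 :> 'I_(1 + n.+1) by apply: val_inj.
transitivity (- ((1 - 'X) * rchar R s)
  + B (lshift _ 0) (lshift _ 0) + B (rshift 1 p) (rshift 1 p)
  - B (lshift _ 0) (rshift 1 p) - B (rshift 1 p) (lshift _ 0)); first by [].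
rewrite /B block_mxEul block_mxEdr block_mxEur block_mxEdl.
by move: (\adj _) => C; rewrite !mxE eqxx mulr1n; ring.
Qed.

(** The value at y of q(E) applied to the rising factorial of length n, where E
    is the backward shift f(y) |-> f(y - 1); that is, X^k |-> rising (y - k) n. *)
Definition shift_rising (R : comNzRingType) (y : R) n (q : {poly R}) : R :=
  \sum_(k < size q) q`_k * rising (y - k%:R) n.

Section FallingEval.
Variables (R : comNzRingType) (y : R).
Local Notation L := (shift_rising y).

Lemma shift_risingE n N (q : {poly R}) : (size q <= N)%N ->
  L n q = \sum_(k < N) q`_k * rising (y - k%:R) n.
Proof.
move=> le; rewrite /shift_rising.
rewrite (big_ord_widen N (fun k => q`_k * rising (y - k%:R) n)) //.
rewrite big_mkcond; apply: eq_bigr => k _; case: ltnP => // /(nth_default 0) ->.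
by rewrite mul0r.
Qed.

Lemma shift_rising_is_linear n : linear_for *%R (L n).
Proof.
move=> a p q; pose N := maxn (size p) (size q).
rewrite (@shift_risingE _ N p) ?leq_maxl // (@shift_risingE _ N q) ?leq_maxr //.
rewrite (@shift_risingE _ N); last first.
  rewrite (leq_trans (size_polyD _ _)) // geq_max leq_maxr andbT.
  by rewrite (leq_trans (size_scale_leq _ _)) ?leq_maxl.
rewrite mulr_sumr -big_split; apply: eq_bigr => k _ /=.
by rewrite coefD coefZ mulrDl mulrA.
Qed.

HB.instance Definition _ n :=
  GRing.isLinear.Build R {poly R} R *%R (L n) (shift_rising_is_linear n).

Lemma shift_risingXn n k : L n 'X^k = rising (y - k%:R) n.
Proof.
rewrite (@shift_risingE _ k.+1) ?size_polyXn // big_ord_recr /= coefXn eqxx mul1r.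
rewrite big1 ?add0r // => i _; rewrite coefXn ltn_eqF ?mul0r //.
Qed.

Lemma shift_rising_natl n c (q : {poly R}) : L n (c%:R * q) = c%:R * L n q.
Proof. by rewrite mulr_natl raddfMn /= mulr_natl. Qed.

(** The backward difference of a rising factorial of length n + 1 is n + 1 times
    the one of length n. *)
Lemma shift_rising_diff n (q : {poly R}) : L n.+1 ((1 - 'X) * q) = n.+1%:R * L n q.
Proof.
rewrite -[q]coefK poly_def mulr_sumr !linear_sum mulr_sumr.
apply: eq_bigr => k _; rewrite -scalerAr !linearZ /= mulrCA; congr (_ * _).
rewrite mulrBl mul1r -exprS linearB /= !shift_risingXn risingSr risingSl.
rewrite -natr1 opprD addrA subrK -natr1; ring.
Qed.

(** Multiplication by y, expressed on the side of q: on X^k it comes from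
    y = ((y - k) + n) - n + k. *)
Lemma shift_rising_mul n (q : {poly R}) :
  n.+1%:R * (y * L n q) =
  L n.+1 (n.+1%:R * q - n%:R * (1 - 'X) * q + 'X * (1 - 'X) * q^`()).
Proof.
rewrite -[q]coefK poly_def linear_sum [(\sum_(_ < _) _)^`()]linear_sum.
rewrite !mulr_sumr -sumrB -big_split !linear_sum /=.
apply: eq_bigr => k _.
have -> : n.+1%:R * (q`_k *: 'X^k) - n%:R * (1 - 'X) * (q`_k *: 'X^k) +
    'X * (1 - 'X) * (q`_k *: 'X^k)^`() =
    q`_k *: (n.+1%:R * 'X^k - n%:R * ((1 - 'X) * 'X^k) + k%:R * ((1 - 'X) * 'X^k)).
  rewrite derivZ derivXn; case: (k : nat) => [|j].
    by rewrite mulr0n scaler0 -!mul_polyC; ring.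
  by rewrite -!mul_polyC -mulr_natl exprS /=; ring.
rewrite !linearZ /= mulrCA [in LHS]mulrA mulrCA; congr (_ * _).
rewrite linearD linearB /= !shift_rising_natl shift_rising_diff !shift_risingXn.
by rewrite risingSr -natr1; move: (rising _ n) => r; ring.
Qed.

End FallingEval.

(** The factor n (n + 1) is natural here: by [shift_rising_diff], the right-hand
    side is n + 1 times the action of rchar / (1 - X) on the rising factorial of
    length n, without the division. *)
Theorem cycle_sum_rchar (R : numDomainType) (y : R) n (tau : 'S_n.+1) :
  n.+1%:R * n.+2%:R * cycle_sum y tau = shift_rising y n.+2 (rchar R tau).
Proof.
elim: n tau => [|n IHn] tau.
  rewrite cycle_sum1.
  have -> : rchar R tau = 1 - 'X.
    by rewrite /rchar det_mx11 !mxE /= ord1 eqxx mulr1.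
  rewrite -[1 - 'X]mulr1 shift_rising_diff -(expr0 'X) shift_risingXn.
  by rewrite risingSr /rising big_ord0; ring.
case: (insert0P tau) => j [s ->]; case: (unliftP 0 j) => [p|] ->; last first.
  rewrite tperm1 mul1g cycle_sum_lift0 rchar_lift0 shift_rising_diff -IHn; ring.
apply: (@mulfI _ n.+1%:R); first by rewrite pnatr_eq0.
rewrite cycle_sum_insert0 rchar_insert0.
set g := rchar R s; set S := \sum_(i | i != p) _.
have SE : n.+1%:R * n.+2%:R * S =
    shift_rising y n.+2 (\sum_(i | i != p) rchar R (tperm i p * s)%g).
  by rewrite linear_sum mulr_sumr; apply: eq_bigr => i _; rewrite IHn.
transitivity (n.+3%:R * (y * (n.+1%:R * n.+2%:R * cycle_sum y s))
  + n.+3%:R * (n.+1%:R * n.+2%:R * S)).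
  by ring.
rewrite IHn SE shift_rising_mul -shift_rising_diff sum_rchar_tperm -linearD /=.
rewrite -/g -shift_rising_natl; congr (shift_rising _ _ _).
rewrite -[n.+3%:R]natr1 -[n.+2%:R]natr1; ring.
Qed.

(** * The rim permutation *)

(** In Leibniz' formula, only the identity contributes: any other permutation
    would have to raise f wherever it moves a point, but it preserves the sum of
    the values of f. *)
Lemma det_ranked (R : comPzRingType) n (A : 'M[R]_n) (f : 'I_n -> nat) :
    (forall i, A i i = 1) ->
    (forall i j, i != j -> (f j <= f i)%N -> A i j = 0) ->
  \det A = 1.
Proof.
move=> A1 A0; rewrite /determinant (bigD1 1%g) //= odd_perm1 mul1r.
rewrite (eq_bigr (fun=> 1)) => [|i _]; last by rewrite perm1 A1.
rewrite big1_eq big1 ?addr0 // => s s1.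
suff [i /A0 Ai /Ai Asi] : exists2 i, i != s i & (f (s i) <= f i)%N.
  by rewrite (bigD1 i) //= Asi mul0r mulr0.
apply/exists_inP; rewrite -[X in is_true X]negbK negb_exists_in.
apply/negP=> /forall_inP lt_f.
have le_f i : (f i <= f (s i))%N.
  by have [<- //|/lt_f] := eqVneq i (s i); rewrite -ltnNge => /ltnW.
have sum_f : (\sum_i f i = \sum_i f (s i))%N by rewrite (reindex_perm s).
have [i] : exists i, i != s i.
  apply/existsP; rewrite -[X in is_true X]negbK negb_exists; apply/negP=> /forallP e.
  case/eqP: s1; apply/permP=> i; rewrite perm1; apply/esym/eqP.
  by rewrite -[_ == _]negbK e.
move=> si; have := lt_f i si; rewrite -ltnNge => lti.
have: (\sum_i f i < \sum_i f (s i))%N.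
  rewrite [X in (X < _)%N](bigD1 i) // [X in (_ < X)%N](bigD1 i) //=.
  by rewrite -addSn leq_add // leq_sum.
by rewrite -sum_f ltnn.
Qed.

(** X is a set of representatives of the cycles, and f certifies that every cycle
    meets it.  For each x in X, the combination of the rows of 1 - X P along the
    cycle of x, with weights 1, X, X^2, ..., telescopes to (1 - X^c) e_x; once
    these rows are factored out, what remains is unitriangular in the order given
    by f. *)
Lemma rchar_transversal (R : comNzRingType) n (s : 'S_n)
    (X : {set 'I_n}) (f : 'I_n -> nat) :
    (forall i, i \notin X -> (f i < f (s i))%N) ->
    (forall x y, x \in X -> y \in X -> y \in porbit s x -> y = x) ->
  rchar R s = \prod_(x in X) (1 - 'X^#|porbit s x|).
Proof.
move=> f_lt X_sep.
pose N : 'M[{poly R}]_n := \matrix_(i, j)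
  if i \in X then \sum_(a < #|porbit s i|) 'X^a * ((s ^+ a)%g i == j)%:R else (i == j)%:R.
pose U : 'M[{poly R}]_n := \matrix_(i, j)
  if i \in X then (i == j)%:R else resolvent R s i j.
pose d : 'rV[{poly R}]_n := \row_i if i \in X then 1 - 'X^#|porbit s i| else 1.
have s_neq i a : (0 < a < #|porbit s i|)%N -> (s ^+ a)%g i != i.
  case/andP=> a0 ak; have k0 := ltn_trans a0 ak.
  have := nth_uniq i (_ : 0 < _)%N (_ : a < _)%N (uniq_traject_porbit s i).
  rewrite size_traject => /(_ k0 ak); rewrite !nth_traject //= permX eq_sym => ->.
  by case: (a) a0.
have NM : N *m resolvent R s = diag_mx d *m U.
  apply/matrixP=> i j; rewrite mul_diag_mx !mxE.
  case: ifP => iX; last first.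
    rewrite mul1r (bigD1 i) //= big1 => [|l li].
      by rewrite !mxE iX eqxx mul1r addr0.
    by rewrite [N i l]mxE iX eq_sym (negPf li) mul0r.
  transitivity (\sum_(0 <= a < #|porbit s i|)
     (('X^a : {poly R}) * ((s ^+ a)%g i == j)%:R
       - 'X^(a.+1) * ((s ^+ a.+1)%g i == j)%:R)).
    rewrite big_mkord.
    under eq_bigr => l _ do rewrite [N i l]mxE iX mulr_suml.
    rewrite exchange_big /=; apply: eq_bigr => a _.
    rewrite (bigD1 ((s ^+ a)%g i)) //= big1 => [|l li]; last first.
      by rewrite eq_sym (negPf li) mulr0 mul0r.
    by rewrite eqxx mulr1 addr0 !mxE expgSr permM exprSr; ring.
  have tele m : \sum_(0 <= a < m)
     (('X^a : {poly R}) * ((s ^+ a)%g i == j)%:R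
       - 'X^(a.+1) * ((s ^+ a.+1)%g i == j)%:R) =
     (i == j)%:R - 'X^m * ((s ^+ m)%g i == j)%:R :> {poly R}.
    elim: m => [|m IHm]; first by rewrite big_nil expg0 perm1 expr0 mul1r subrr.
    by rewrite big_nat_recr //= IHm addrA subrK.
  by rewrite tele permX iter_porbit mulrBl mul1r.
have detN : \det N = 1.
  apply: (@det_ranked _ _ _ (fun j => j \notin X : nat)) => [i|i j ij]; rewrite !mxE.
    case: ifP => iX; last by rewrite eqxx.
    have : (0 < #|porbit s i|)%N by rewrite lt0n card_porbit_neq0.
    move: (s_neq i); case: #|porbit s i| => // k sk _.
    rewrite big_ord_recl big1 => [|a _].
      by rewrite expr0 expg0 perm1 eqxx mulr1 addr0.
    by rewrite (negPf (sk (lift ord0 a) _)) ?mulr0 // (ltn_ord (lift ord0 a)).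
  case: ifP => iX; last by rewrite (negPf ij).
  rewrite /=; case: (boolP (j \in X)) => // jX _; rewrite big1 // => a _.
  case: eqP => [e|_]; rewrite ?mulr0 //.
  have jp : j \in porbit s i by rewrite -e mem_porbit.
  by move: ij; rewrite (X_sep i j) ?eqxx.
have detU : \det U = 1.
  apply: (@det_ranked _ _ _ f) => [i|i j ij fij]; rewrite !mxE.
    case: ifP => iX; first by rewrite eqxx.
    have := f_lt i; rewrite iX => /(_ isT).
    by case: (eqVneq (s i) i) => [->|]; rewrite ?ltnn // eqxx mulr0 subr0.
  case: ifP => iX; first by rewrite (negPf ij).
  have := f_lt i; rewrite iX => /(_ isT) lti.
  rewrite (negPf ij) sub0r; case: eqP => [e|]; last by rewrite mulr0 oppr0.
  by move: lti; rewrite e ltnNge fij.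
have := congr1 determinant NM.
rewrite !det_mulmx detN detU mul1r mulr1 det_diag /rchar => ->.
by rewrite [RHS]big_mkcond /=; apply: eq_bigr => i _; rewrite mxE.
Qed.

Lemma outside_ex (T : finType) (A : {set T}) : A != setT -> exists b, b \notin A.
Proof.
move=> AT; apply/existsP; rewrite -negb_forall; apply: contra AT => /forallP all_A.
by apply/eqP/setP=> b; rewrite inE all_A.
Qed.

Lemma porbit_ascending (T : finType) (s : {perm T}) (f : T -> nat) (A : {set T}) x :
    x \in A -> (forall i, i \in A -> s i \in A) ->
    (forall i, i \in A -> i != x -> (f i < f (s i))%N) ->
  porbit s x = A.
Proof.
move=> xA sA f_lt; apply/eqP; rewrite eqEsubset; apply/andP; split; apply/subsetP=> y.
  case/porbitP=> k ->; elim: k => [|k IHk]; first by rewrite expg0 perm1.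
  by rewrite expgSr permM sA.
have [k] := ubnP (\max_i f i - f y)%N; elim: k y => // k IHk y lek yA.
have [-> | yx] := eqVneq y x; first exact: porbit_id.
have lt_y := f_lt y yA yx.
suff: s y \in porbit s x by rewrite -!eq_porbit_mem -(porbit_perm s 1 y) expg1.
apply: IHk; last exact: sA.
have : (f (s y) <= \max_i f i)%N by exact: leq_bigmax.
by lia.
Qed.

Section Next.
Variable n : nat.
Implicit Types (A : {set 'I_n}) (i j : 'I_n).

(** Orders the indices cyclically, starting just after i and ending with i. *)
Definition ahead i j : nat := if (i < j)%N then j : nat else (j + n)%N.

(** The first element of A met when going up cyclically from i, which itself
    comes last. *)
Definition nxt A i : 'I_n :=
  if [pick j in A] is Some j0 then [arg min_(j < j0 in A) ahead i j] else i.

Lemma nxtP A i j0 : j0 \in A ->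
  nxt A i \in A /\ forall j, j \in A -> (ahead i (nxt A i) <= ahead i j)%N.
Proof.
move=> j0A; rewrite /nxt; case: pickP => [j1 j1A|/(_ j0)]; last by rewrite j0A.
by case: arg_minnP.
Qed.

Lemma nxt_unique A i j : j \in A ->
  (forall j', j' \in A -> (ahead i j <= ahead i j')%N) -> nxt A i = j.
Proof.
move=> jA jmin; have [nA nmin] := nxtP i jA; apply/val_inj => /=.
move: (jmin _ nA) (nmin _ jA) (ltn_ord j) (ltn_ord (nxt A i)); rewrite /ahead.
by case: (ltnP i j) => ?; case: (ltnP i (nxt A i)) => ?; lia.
Qed.

Lemma mem_nxt A i : i \in A -> nxt A i \in A.
Proof. by move=> iA; case: (nxtP i iA). Qed.

Lemma val_ordS i : ordS i = (if (i.+1 < n)%N then i.+1 else 0%N) :> nat.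
Proof.
rewrite /=; case: ltnP => [/modn_small //|ni].
by have -> : i.+1 = n; rewrite ?modnn //; apply/eqP; rewrite eqn_leq ni ltn_ord.
Qed.

Lemma nxt_ordS A i : ordS i \in A -> nxt A i = ordS i.
Proof.
move=> iA; apply: nxt_unique => // j _; move: (ltn_ord i) (ltn_ord j).
rewrite /ahead val_ordS; case: (ltnP i.+1 n) => ?; rewrite ?ltn0 ?ltnSn;
  repeat case: ifP => ?; lia.
Qed.

Lemma nxt_skip A i j0 : j0 \in A -> ordS i \notin A -> nxt A i = nxt A (ordS i).
Proof.
move=> j0A iA; have [nA nmin] := nxtP (ordS i) j0A; apply: nxt_unique => // j jA.
have neq k : k \in A -> k != (if (i.+1 < n)%N then i.+1 else 0%N) :> nat.
  by move=> kA; rewrite -val_ordS; apply: contraNneq iA => /val_inj <-.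
move: (nmin j jA) (neq _ nA) (neq j jA) (ltn_ord i) (ltn_ord j).
move: (ltn_ord (nxt A (ordS i))).
rewrite /ahead val_ordS; move: (nxt A _) => k.
by case: (ltnP i.+1 n) => ?; rewrite ?ltn0 ?ltnSn; repeat case: ifP => ?; lia.
Qed.

Lemma nxt_ascend A i j : j \in A -> (i < j)%N -> (i < nxt A i)%N.
Proof.
move=> jA ij; case: (nxtP i jA) => _ /(_ j jA); rewrite /ahead ij.
by case: ltnP => // _; have := ltn_ord j; lia.
Qed.

Lemma nxt_inj A : {in A &, injective (nxt A)}.
Proof.
move=> i j iA jA eq_n; apply/val_inj => /=.
have [_ imin] := nxtP i iA; have [_ jmin] := nxtP j jA.
move: (imin _ iA) (imin _ jA) (jmin _ iA) (jmin _ jA).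
rewrite eq_n /ahead; move: (ltn_ord i) (ltn_ord j) (ltn_ord (nxt A j)).
by rewrite !ltnn; repeat case: ifP => ?; lia.
Qed.

Definition prv A i : 'I_n := rev_ord (nxt (@rev_ord n @^-1: A) (rev_ord i)).

Lemma mem_rev A i : (rev_ord i \in @rev_ord n @^-1: A) = (i \in A).
Proof. by rewrite inE rev_ordK. Qed.

Lemma val_ord_pred i : ord_pred i = (if (0 < i)%N then i.-1 else n.-1) :> nat.
Proof.
have lti := ltn_ord i; rewrite /=; case: ltnP => i0.
  by rewrite (_ : (i + n).-1 = i.-1 + n)%N ?modnDr ?modn_small //; lia.
by rewrite (_ : (i + n).-1 = n.-1)%N ?modn_small //; lia.
Qed.

Lemma rev_ord_pred i : rev_ord (ord_pred i) = ordS (rev_ord i).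
Proof.
apply/ord_inj; rewrite val_ordS [LHS]/= -/(ord_pred i).
rewrite -[((i + n).-1 %% n)%N]/(ord_pred i : nat) val_ord_pred /=.
by have lti := ltn_ord i; do 2! case: ifP => ?; lia.
Qed.

Lemma mem_prv A i : i \in A -> prv A i \in A.
Proof. by rewrite -mem_rev => /mem_nxt; rewrite inE. Qed.

Lemma prv_pred A i : ord_pred i \in A -> prv A i = ord_pred i.
Proof.
by rewrite -mem_rev rev_ord_pred /prv => /nxt_ordS ->; rewrite -rev_ord_pred rev_ordK.
Qed.

Lemma prv_skip A i j0 : j0 \in A -> ord_pred i \notin A -> prv A i = prv A (ord_pred i).
Proof.
rewrite -mem_rev => j0A; rewrite -mem_rev rev_ord_pred => iA.
by rewrite /prv (nxt_skip j0A iA) rev_ord_pred.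
Qed.

Lemma prv_descend A i j : j \in A -> (j < i)%N -> (prv A i < i)%N.
Proof.
rewrite -mem_rev => jA ji; have := nxt_ascend (i := rev_ord i) jA.
rewrite /prv /=; have := ltn_ord i.
have := ltn_ord (nxt (@rev_ord n @^-1: A) (rev_ord i)).
by move=> ? ? /(_ _); lia.
Qed.

Lemma prv_inj A : {in A &, injective (prv A)}.
Proof.
move=> i j iA jA /rev_ord_inj /nxt_inj; rewrite !mem_rev => /(_ iA jA).
exact: rev_ord_inj.
Qed.

Definition rim_fun A i : 'I_n := if i \in A then nxt A i else prv (~: A) i.

Lemma rim_fun_mem A i : (rim_fun A i \in A) = (i \in A).
Proof.
rewrite /rim_fun; case: ifPn => iA; first by rewrite mem_nxt.
by apply/negbTE; rewrite -in_setC mem_prv // in_setC.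
Qed.

Lemma rim_fun_inj A : injective (rim_fun A).
Proof.
move=> i j eq_ij; have := rim_fun_mem A i; rewrite eq_ij rim_fun_mem => eqA.
move: eq_ij; rewrite /rim_fun -eqA; case: ifPn => jA.
  by apply: nxt_inj; rewrite // -eqA.
by apply: prv_inj; rewrite in_setC // -eqA.
Qed.

Definition rim A : 'S_n := perm (@rim_fun_inj A).

(** Increases along [rim A], except at the greatest element of A and at the least
    element of its complement, where the two cycles close up. *)
Definition rank A i : nat := if i \in A then i : nat else (n - i)%N.

Lemma rim_mem A i : (rim A i \in A) = (i \in A).
Proof. by rewrite permE rim_fun_mem. Qed.

Lemma rank_in A i j : i \in A -> j \in A -> (i < j)%N -> (rank A i < rank A (rim A i))%N.
Proof.
move=> iA jA ij; rewrite /rank rim_mem iA permE /rim_fun iA.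
exact: nxt_ascend jA ij.
Qed.

Lemma rank_out A i j : i \notin A -> j \notin A -> (j < i)%N ->
  (rank A i < rank A (rim A i))%N.
Proof.
move=> iA jA ji; rewrite /rank rim_mem (negPf iA) permE /rim_fun (negPf iA).
have := @prv_descend (~: A) i j; rewrite in_setC jA => /(_ isT ji).
by have := ltn_ord i; lia.
Qed.

Lemma rim_top A i0 : i0 \in A ->
  exists2 x, x \in A &
    (forall i, i \in A -> i != x -> (rank A i < rank A (rim A i))%N) /\
    porbit (rim A) x = A.
Proof.
move=> i0A; case: (arg_maxnP (fun i : 'I_n => i : nat) i0A) => x xA xmax.
have asc i : i \in A -> i != x -> (rank A i < rank A (rim A i))%N.
  move=> iA ix; apply: (rank_in iA xA).
  by rewrite ltn_neqAle [X in X && _]ix; exact: xmax.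
exists x => //; split=> //; apply: (porbit_ascending (f := rank A)) => // i iA.
by rewrite rim_mem.
Qed.

Lemma rim_bottom A i0 : i0 \notin A ->
  exists2 x, x \notin A &
    (forall i, i \notin A -> i != x -> (rank A i < rank A (rim A i))%N) /\
    porbit (rim A) x = ~: A.
Proof.
move=> i0A; have [x xA xmin] :=
  @arg_minnP _ i0 (fun i => i \notin A) (fun i : 'I_n => i : nat) i0A.
have asc i : i \notin A -> i != x -> (rank A i < rank A (rim A i))%N.
  move=> iA ix; apply: (rank_out iA xA).
  by rewrite ltn_neqAle eq_sym [X in X && _]ix; exact: xmin.
exists x => //; split=> //; apply: (porbit_ascending (f := rank A)).
- by rewrite in_setC.
- by move=> i; rewrite !in_setC rim_mem.
by move=> i; rewrite in_setC; exact: asc.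
Qed.

Lemma rchar_rim (R : comNzRingType) A : (0 < n)%N ->
  rchar R (rim A) =
    if (A == set0) || (A == setT) then 1 - 'X^n
    else (1 - 'X^#|A|) * (1 - 'X^(n - #|A|)).
Proof.
move=> n0; have cardCA : #|~: A| = (n - #|A|)%N by rewrite cardsCs setCK card_ord.
have [A0 | [i0 i0A]] := set_0Vmem A; have [B0 | [i1 i1B]] := set_0Vmem (~: A).
- by move: B0; rewrite A0 setC0 => /setP/(_ (Ordinal n0)); rewrite !inE.
- subst A; rewrite eqxx /=; rewrite in_setC in i1B.
  case: (rim_bottom i1B) => x xA [asc px].
  rewrite (@rchar_transversal _ _ _ [set x] (rank set0)).
  + by rewrite big_set1 px cardCA cards0 subn0.
  + by move=> i; rewrite in_set1 => ix; apply: asc => //; rewrite inE.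
  + by move=> ? ?; rewrite !in_set1 => /eqP -> /eqP ->.
- have AT : A = setT by rewrite -[A]setCK B0 setC0.
  subst A; rewrite eqxx orbT.
  case: (rim_top i0A) => x xA [asc px].
  rewrite (@rchar_transversal _ _ _ [set x] (rank setT)).
  + by rewrite big_set1 px cardsT card_ord.
  + by move=> i; rewrite in_set1 => ix; apply: asc => //; rewrite inE.
  + by move=> ? ?; rewrite !in_set1 => /eqP -> /eqP ->.
rewrite in_setC in i1B; rewrite ifF; last first.
  apply/norP; split; apply/eqP=> e; first by rewrite e inE in i0A.
  by rewrite e inE in i1B.
case: (rim_top i0A) => x xA [ascA px]; case: (rim_bottom i1B) => y yA [ascB py].
have xy : x != y by apply: contraNneq yA => <-.
rewrite (@rchar_transversal _ _ _ [set x; y] (rank A)).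
- by rewrite big_setU1 ?in_set1 //= big_set1 px py cardCA.
- move=> i; rewrite !inE negb_or => /andP[ix iy].
  by case: (boolP (i \in A)) => iA; [apply: ascA | apply: ascB].
move=> a b; rewrite !inE => /orP[]/eqP-> /orP[]/eqP-> //.
  by rewrite px (negPf yA).
by rewrite py in_setC xA.
Qed.

End Next.

(** * Rotation systems and faces of the wheel *)

Lemma ncyc1P n (s : 'S_n.+1) : reflect (forall i j, j \in porbit s i) (ncyc s == 1%N).
Proof.
apply: (iffP idP) => [|all_in].
  move=> /cards1P[O sO] i j; rewrite -eq_porbit_mem.
  have mem_O k : porbit s k = O by apply/set1P; rewrite -sO imset_f.
  by rewrite !mem_O.
apply/cards1P; exists (porbit s 0); apply/setP=> O; rewrite in_set1.
apply/imsetP/eqP => [[i _ ->]|->]; last by exists 0.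
by apply/eqP; rewrite eq_porbit_mem.
Qed.

Lemma iter_ordS n k (i : 'I_n) : iter k (@ordS _) i = ((i + k) %% n)%N :> nat.
Proof.
elim: k => [|k IHk]; first by rewrite addn0 modn_small.
by rewrite iterS [LHS]/= IHk -addn1 modnDml addn1 addnS.
Qed.

Lemma iter_ordS_ex n (i j : 'I_n) : exists k, iter k.+1 (@ordS _) i = j.
Proof.
have [lti ltj] := (ltn_ord i, ltn_ord j).
exists (j + n - i).-1; apply: ord_inj; rewrite iter_ordS.
by rewrite (_ : i + _ = j + n)%N ?modnDr ?modn_small //; lia.
Qed.

Lemma iter_ord_pred_ex n (i j : 'I_n) : exists k, iter k.+1 (@ord_pred _) i = j.
Proof.
have [k rk] := iter_ordS_ex (rev_ord i) (rev_ord j); exists k.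
apply: rev_ord_inj; rewrite -rk; elim: k.+1 => // l IHl.
by rewrite !iterS rev_ord_pred IHl.
Qed.

Section WheelDarts.
Variables (n' : nat).
Local Notation n := n'.+3.
Implicit Types (A : {set 'I_n}) (i j : 'I_n) (s : 'S_n).

Lemma ordS_neq i : i != ordS i.
Proof. by rewrite -(inj_eq (@ord_inj _)) val_ordS; case: ifP => ?; lia. Qed.

Lemma ordS_neq_pred i : ordS i != ord_pred i.
Proof.
rewrite -(inj_eq (@ord_inj _)) val_ordS val_ord_pred.
by have := ltn_ord i; case: ifP => ?; case: ifP => ?; lia.
Qed.

Lemma rgt_subproof i : wheel n (Some i) (Some (ordS i)).
Proof. by rewrite /= /cycle_adj eqxx ordS_neq. Qed.

Lemma lft_subproof i : wheel n (Some i) (Some (ord_pred i)).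
Proof.
rewrite /= /cycle_adj ord_predK eqxx orbT andbT.
by rewrite -[X in X != _]ord_predK eq_sym ordS_neq.
Qed.

(** [hub i] and [spk i] are the two ends of the spoke i, at the hub and at the rim;
    [rgt i] and [lft i] are the ends at i of the two rim edges. *)
Definition hub i : dart (wheel n) := exist _ (None, Some i) isT.
Definition spk i : dart (wheel n) := exist _ (Some i, None) isT.
Definition rgt i : dart (wheel n) := exist _ (Some i, Some (ordS i)) (rgt_subproof i).
Definition lft i : dart (wheel n) := exist _ (Some i, Some (ord_pred i)) (lft_subproof i).

Variant dart_spec : dart (wheel n) -> Prop :=
  | DartHub i : dart_spec (hub i)
  | DartSpk i : dart_spec (spk i)
  | DartRgt i : dart_spec (rgt i)
  | DartLft i : dart_spec (lft i).

Lemma dartP d : dart_spec d.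
Proof.
case: d => [[[i|] [j|]] /= ij] //; last first.
- by rewrite (_ : exist _ _ _ = hub j); [constructor | apply: val_inj].
- by rewrite (_ : exist _ _ _ = spk i); [constructor | apply: val_inj].
case/andP: (ij) => _ /orP[/eqP e|/eqP e].
  by rewrite (_ : exist _ _ _ = rgt i); [constructor | apply: val_inj; rewrite /= e].
rewrite (_ : exist _ _ _ = lft i); first by constructor.
by apply: val_inj; rewrite /= e ordSK.
Qed.

Lemma rgt_neq_lft i : rgt i != lft i.
Proof.
by apply: contra_neq (ordS_neq_pred i) => /(congr1 (fun d => odflt i (val d).2)).
Qed.

Lemma spk_neq_rgt i : spk i != rgt i.
Proof. by apply/eqP=> /(congr1 val). Qed.

Lemma spk_neq_lft i : spk i != lft i.
Proof. by apply/eqP=> /(congr1 val). Qed.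

Lemma hub_inj : injective hub.
Proof. by move=> i j e; have := congr1 (fun d => odflt i (val d).2) e. Qed.

(** A selects one of the two cyclic orders of the three darts at each rim vertex. *)
Definition rot_fun A s (d : dart (wheel n)) : dart (wheel n) :=
  match val d with
  | (None, Some i) => hub (s i)
  | (Some i, None) => if i \in A then rgt i else lft i
  | (Some i, Some j) =>
      if j == ordS i then (if i \in A then lft i else spk i)
      else (if i \in A then spk i else rgt i)
  | (None, None) => d
  end.

Lemma rot_fun_hub A s i : rot_fun A s (hub i) = hub (s i). Proof. by []. Qed.
Lemma rot_fun_spk A s i : rot_fun A s (spk i) = if i \in A then rgt i else lft i.
Proof. by []. Qed.
Lemma rot_fun_rgt A s i : rot_fun A s (rgt i) = if i \in A then lft i else spk i.
Proof. by rewrite /rot_fun /= eqxx. Qed.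
Lemma rot_fun_lft A s i : rot_fun A s (lft i) = if i \in A then spk i else rgt i.
Proof. by rewrite /rot_fun /= eq_sym (negPf (ordS_neq_pred i)). Qed.

Definition rot_funE := (rot_fun_hub, rot_fun_spk, rot_fun_rgt, rot_fun_lft).

Lemma tail_rot_fun A s d : tail (rot_fun A s d) = tail d.
Proof. by case: (dartP d) => i; rewrite rot_funE //; case: ifP. Qed.

Lemma rot_fun_inj A s : injective (rot_fun A s).
Proof.
move=> d d' e; have := congr1 (@tail _ _) e; rewrite !tail_rot_fun.
move: e; have [[nrl nsr] nsl] := (rgt_neq_lft, spk_neq_rgt, spk_neq_lft).
case: (dartP d) => i; case: (dartP d') => j //; rewrite !rot_funE;
  first by move=> /hub_inj /perm_inj ->.
all: move=> /[swap] -[<-] //; case: ifP => _ /eqP;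
  by rewrite ?(negPf (nrl _)) ?(negPf (nsr _)) ?(negPf (nsl _))
     ?[_ == spk _]eq_sym ?[lft _ == _]eq_sym
     ?(negPf (nrl _)) ?(negPf (nsr _)) ?(negPf (nsl _)).
Qed.

Definition wheel_rot A s : {perm dart (wheel n)} := perm (@rot_fun_inj A s).

Lemma rot_hub A s i : wheel_rot A s (hub i) = hub (s i).
Proof. by rewrite permE. Qed.
Lemma rot_spk A s i : wheel_rot A s (spk i) = if i \in A then rgt i else lft i.
Proof. by rewrite permE. Qed.
Lemma rot_rgt A s i : wheel_rot A s (rgt i) = if i \in A then lft i else spk i.
Proof. by rewrite permE rot_fun_rgt. Qed.
Lemma rot_lft A s i : wheel_rot A s (lft i) = if i \in A then spk i else rgt i.
Proof. by rewrite permE rot_fun_lft. Qed.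

Lemma wheel_rot_inj A s A' s' : wheel_rot A s = wheel_rot A' s' -> A = A' /\ s = s'.
Proof.
move/permP=> e; split.
  apply/setP=> i; have := e (spk i); rewrite !rot_spk.
  have nrl := rgt_neq_lft i.
  by do 2![case: (i \in _)] => // rl; rewrite rl eqxx in nrl.
by apply/permP=> i; apply: hub_inj; rewrite -(rot_hub A) -(rot_hub A' s') e.
Qed.

Lemma rotation_rot A s : ncyc s == 1%N -> rotation_system (wheel_rot A s).
Proof.
move=> /ncyc1P s1; apply/forallP=> d; apply/eqP/setP=> d'; rewrite inE.
apply/idP/eqP => [/porbitP[k ->]|].
  elim: k => [|k IHk]; first by rewrite expg0 perm1.
  by rewrite expgSr permM permE tail_rot_fun.
have hubs i j : hub j \in porbit (wheel_rot A s) (hub i).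
  apply: (porbit_homo (psi := wheel_rot A s)) (s1 i j) => k.
  by rewrite -(rot_hub A) porbit_step.
have rims i d1 : tail d1 = Some i -> spk i \in porbit (wheel_rot A s) d1.
  move=> t1; have st d2 : spk i \in porbit (wheel_rot A s) (wheel_rot A s d2) ->
      spk i \in porbit (wheel_rot A s) d2.
    by rewrite -(porbit_perm _ 1 d2) expg1.
  case: (dartP d1) t1 => // j [->]; first exact: porbit_id.
    apply: (st); rewrite rot_rgt; case: ifP => iA; last exact: porbit_id.
    by apply: (st); rewrite rot_lft iA porbit_id.
  apply: (st); rewrite rot_lft; case: ifP => iA; first exact: porbit_id.
  by apply: (st); rewrite rot_rgt iA porbit_id.
case td: (tail d) => [i|] td'.
  have := rims _ _ td; have := rims _ _ td'; rewrite -!eq_porbit_mem.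
  by move=> /eqP <- /eqP ->.
by case: (dartP d) td => // i _; case: (dartP d') td' => // j _; exact: hubs.
Qed.

(** At a rim vertex the rotation is a 3-cycle, so it is determined by the dart
    that follows the spoke. *)
Lemma rotation_rotP rho : rotation_system rho ->
  exists A, exists2 s, ncyc s == 1%N & rho = wheel_rot A s.
Proof.
move=> /forallP rho_rot.
have rhoP d d' : (d' \in porbit rho d) = (tail d' == tail d).
  by rewrite (eqP (rho_rot d)) inE.
have tail_rho d : tail (rho d) = tail d by apply/eqP; rewrite -rhoP porbit_step.
have fixed d : rho d = d -> forall d', tail d' = tail d -> d' = d.
  move=> fd d' /eqP; rewrite -rhoP => /porbitP[k ->].
  by elim: k => [|k IHk]; rewrite ?expg0 ?perm1 // expgSr permM IHk.
have swapped d d1 : rho d = d1 -> rho d1 = d ->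
    forall d', tail d' = tail d -> d' = d \/ d' = d1.
  move=> e1 e2 d' /eqP; rewrite -rhoP => /porbitP[k ->].
  elim: k => [|k IHk]; first by left; rewrite expg0 perm1.
  by rewrite expgSr permM; case: IHk => ->; [right | left].
pose f i := if (val (rho (hub i))).2 is Some j then j else i.
have rho_hub i : rho (hub i) = hub (f i).
  by have := tail_rho (hub i); rewrite /f; case: (dartP (rho (hub i))).
have f_inj : injective f.
  by move=> i j e; apply/hub_inj/(@perm_inj _ rho); rewrite !rho_hub e.
pose s : 'S_n := perm f_inj; pose A := [set i | rho (spk i) == rgt i].
have [[nrl nsr] nsl] := (rgt_neq_lft, spk_neq_rgt, spk_neq_lft).
have spkE i : rho (spk i) = if i \in A then rgt i else lft i.
  rewrite inE; case: ifP => [/eqP //|]; have := tail_rho (spk i).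
  have := fixed (spk i); case: (dartP (rho (spk i))) => // j fx [ij]; subst j.
    by move=> _; have /eqP := nsr i; rewrite (fx erefl (rgt i)).
    by rewrite eqxx.
  by [].
have [rgtE lftE] : (forall i, rho (rgt i) = if i \in A then lft i else spk i) /\
                   (forall i, rho (lft i) = if i \in A then spk i else rgt i).
  have lastE : forall (x y z : dart (wheel n)) (i : 'I_n),
      tail x = Some i -> tail y = Some i -> tail z = Some i ->
      x != y -> y != z -> x != z -> rho x = y ->
      (forall d, tail d = Some i -> [\/ d = x, d = y | d = z]) ->
    rho y = z /\ rho z = x.
    move=> x y z i tx ty tz xy yz xz exy all3.
    have ry : rho y = z.
      have := tail_rho y; rewrite ty => /all3[] // e.
        case: (swapped _ _ exy e z) => [|/eqP|/eqP]; rewrite ?tx // eq_sym;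
          by rewrite ?(negPf xz) ?(negPf yz).
      by have /eqP := xz; rewrite (fixed _ e x) ?tx ?ty // (fixed _ e z) ?tz ?ty.
    split=> //; have := tail_rho z; rewrite tz => /all3[] // e.
      by move: xz; rewrite -(inj_eq (@perm_inj _ rho)) exy e eqxx.
    by move: yz; rewrite -(inj_eq (@perm_inj _ rho)) ry e eqxx.
  have rim3 i d : tail d = Some i -> [\/ d = spk i, d = rgt i | d = lft i].
    by case: (dartP d) => // j [->]; constructor.
  split=> i; have := spkE i; case: ifP => iA e.
  - by case: (lastE (spk i) (rgt i) (lft i) i) => //; exact: rim3.
  - case: (lastE (spk i) (lft i) (rgt i) i) => //; first by rewrite eq_sym.
    by move=> d /rim3[]; constructor.
  - by case: (lastE (spk i) (rgt i) (lft i) i) => //; exact: rim3.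
  case: (lastE (spk i) (lft i) (rgt i) i) => //; first by rewrite eq_sym.
  by move=> d /rim3[]; constructor.
exists A, s.
  apply/ncyc1P => i j.
  have : hub j \in porbit rho (hub i) by rewrite rhoP.
  case/porbitP=> k; elim: k j => [|k IHk] j.
    by rewrite expg0 perm1 => /hub_inj ->; exact: porbit_id.
  rewrite expgSr permM; set d := (rho ^+ k)%g (hub i) => e.
  have td : tail d = None by rewrite -tail_rho -e.
  have [l dl] : exists l, d = hub l by case: (dartP d) td => // l _; exists l.
  have := IHk l (esym dl); move: e; rewrite dl rho_hub => /hub_inj ->.
  rewrite -!eq_porbit_mem => /eqP <-; rewrite eq_porbit_mem porbit_sym.
  by rewrite -[f l]permE -/s porbit_sym porbit_step.
apply/permP=> d; case: (dartP d) => i.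
- by rewrite rot_hub rho_hub permE.
- by rewrite rot_spk.
- by rewrite rot_rgt.
by rewrite rot_lft.
Qed.

Section Faces.
Variables (A : {set 'I_n}) (s : 'S_n).
Let phi := (rev_perm (wheel n) * wheel_rot A s)%g.

Lemma rev_permE d : rev_perm (wheel n) d = dart_rev d.
Proof. exact: permE. Qed.

Lemma face_hub i : phi (hub i) = if i \in A then rgt i else lft i.
Proof.
by rewrite permM rev_permE (_ : dart_rev _ = spk i) ?rot_spk //; exact: val_inj.
Qed.

Lemma face_spk i : phi (spk i) = hub (s i).
Proof.
by rewrite permM rev_permE (_ : dart_rev _ = hub i) ?rot_hub //; exact: val_inj.
Qed.

Lemma face_rgt i : phi (rgt i) = if ordS i \in A then spk (ordS i) else rgt (ordS i).
Proof.
rewrite permM rev_permE (_ : dart_rev _ = lft (ordS i)) ?rot_lft //.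
by apply: val_inj; rewrite /= ordSK.
Qed.

Lemma face_lft i :
  phi (lft i) = if ord_pred i \in A then lft (ord_pred i) else spk (ord_pred i).
Proof.
rewrite permM rev_permE (_ : dart_rev _ = rgt (ord_pred i)) ?rot_rgt //.
by apply: val_inj; rewrite /= ord_predK.
Qed.

Lemma face_step d d' : d' \in porbit phi (phi d) -> d' \in porbit phi d.
Proof. by rewrite -(porbit_perm _ 1 d) expg1. Qed.

(** Induction on the number of rim edges between i and some element of A. *)
Lemma rgt_reach i a : a \in A -> hub (s (nxt A i)) \in porbit phi (rgt i).
Proof.
move=> aA; have [k] := iter_ordS_ex i a; elim: k i => [|k IHk] i ka.
  have iA : ordS i \in A by rewrite -[ordS i]/(iter 1 (@ordS _) i) ka.
  apply: face_step; rewrite face_rgt iA (nxt_ordS iA).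
  by rewrite -face_spk porbit_step.
apply: face_step; rewrite face_rgt; case: ifPn => iA.
  by rewrite (nxt_ordS iA) -face_spk porbit_step.
by rewrite (nxt_skip aA iA); apply: IHk; rewrite -iterSr.
Qed.

Lemma lft_reach i a : a \notin A -> hub (s (prv (~: A) i)) \in porbit phi (lft i).
Proof.
rewrite -in_setC => aA; have [k] := iter_ord_pred_ex i a; elim: k i => [|k IHk] i ka.
  have iA : ord_pred i \in ~: A by rewrite -[ord_pred i]/(iter 1 (@ord_pred _) i) ka.
  apply: face_step; rewrite face_lft (prv_pred iA) ifN -?in_setC //.
  by rewrite -face_spk porbit_step.
apply: face_step; rewrite face_lft; case: ifP => iA; last first.
  by rewrite (@prv_pred _ (~: A)) ?in_setC ?iA // -face_spk porbit_step.
by rewrite (prv_skip aA) ?in_setC ?iA //; apply: IHk; rewrite -iterSr.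
Qed.

Lemma rgt_loop i j : A = set0 -> rgt j \in porbit phi (rgt i).
Proof.
move=> A0; have [k] := iter_ordS_ex i j; elim: k i => [|k IHk] i ka;
  apply: face_step; rewrite face_rgt A0 inE; last by apply: IHk; rewrite -iterSr.
by rewrite -ka porbit_id.
Qed.

Lemma lft_loop i j : A = setT -> lft j \in porbit phi (lft i).
Proof.
move=> AT; have [k] := iter_ord_pred_ex i j; elim: k i => [|k IHk] i ka;
  apply: face_step; rewrite face_lft AT inE; last by apply: IHk; rewrite -iterSr.
by rewrite -ka porbit_id.
Qed.

Let psi := (rim A * s)%g.

Lemma psiE i : psi i = s (if i \in A then nxt A i else prv (~: A) i).
Proof. by rewrite permM permE. Qed.

(** The spoke along which the face through d next leaves the hub, i itself for
    d = hub i; meaningful only if that face visits the hub at all. *)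
Definition next_spoke (d : dart (wheel n)) : 'I_n :=
  match val d with
  | (None, Some i) => i
  | (Some i, None) => s i
  | (Some i, Some j) => if j == ordS i then s (nxt A i) else s (prv (~: A) i)
  | (None, None) => ord0
  end.

Lemma next_spoke_hub i : next_spoke (hub i) = i. Proof. by []. Qed.
Lemma next_spoke_spk i : next_spoke (spk i) = s i. Proof. by []. Qed.
Lemma next_spoke_rgt i : next_spoke (rgt i) = s (nxt A i).
Proof. by rewrite /next_spoke /= eqxx. Qed.
Lemma next_spoke_lft i : next_spoke (lft i) = s (prv (~: A) i).
Proof. by rewrite /next_spoke /= eq_sym (negPf (ordS_neq_pred i)). Qed.

(** The darts of the face that avoids the hub: the rim edges seen from the side
    on which there are no spokes. *)
Definition hubless (d : dart (wheel n)) : bool :=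
  match val d with
  | (Some i, Some j) => if j == ordS i then A == set0 else A == setT
  | _ => false
  end.

Lemma hubless_rgt i : hubless (rgt i) = (A == set0).
Proof. by rewrite /hubless /= eqxx. Qed.

Lemma hubless_lft i : hubless (lft i) = (A == setT).
Proof. by rewrite /hubless /= eq_sym (negPf (ordS_neq_pred i)). Qed.

Lemma hubless_face d : hubless (phi d) = hubless d.
Proof.
have in_A0 i : i \in A -> (A == set0) = false.
  by move=> iA; apply/negbTE/set0Pn; exists i.
have in_AT i : i \notin A -> (A == setT) = false.
  by apply: contraNF => /eqP ->; rewrite inE.
case: (dartP d) => i.
- rewrite face_hub; case: ifPn => iA; rewrite ?hubless_rgt ?hubless_lft.
    exact: in_A0 iA.
  exact: in_AT iA.
- by rewrite face_spk.
- rewrite face_rgt; case: ifP => iA; rewrite !hubless_rgt // (in_A0 _ iA) //.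
rewrite face_lft; case: ifPn => iA; rewrite !hubless_lft // (in_AT _ iA) //.
Qed.

Lemma hub_reach d : ~~ hubless d -> hub (next_spoke d) \in porbit phi d.
Proof.
case: (dartP d) => i.
- by rewrite next_spoke_hub porbit_id.
- by rewrite next_spoke_spk -face_spk porbit_step.
- by rewrite hubless_rgt next_spoke_rgt => /set0Pn[a]; apply: rgt_reach.
by rewrite hubless_lft next_spoke_lft => /outside_ex[b]; apply: lft_reach.
Qed.

Lemma next_spoke_face_hub i : next_spoke (phi (hub i)) = psi i.
Proof.
by rewrite face_hub psiE; case: ifP; rewrite ?next_spoke_rgt ?next_spoke_lft.
Qed.

Lemma next_spoke_face d : ~~ hubless d ->
  next_spoke (phi d) \in porbit psi (next_spoke d).
Proof.
case: (dartP d) => i.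
- by rewrite next_spoke_face_hub next_spoke_hub porbit_step.
- by rewrite face_spk next_spoke_spk porbit_id.
- rewrite hubless_rgt => /set0Pn[a aA]; rewrite face_rgt.
  case: ifPn => iA; rewrite ?next_spoke_spk !next_spoke_rgt.
    by rewrite (nxt_ordS iA) porbit_id.
  by rewrite (nxt_skip aA iA) porbit_id.
rewrite hubless_lft => /outside_ex[b bA]; rewrite face_lft.
case: ifP => iA; rewrite ?next_spoke_spk !next_spoke_lft.
  by rewrite [in X in _ \in porbit _ (s X)](prv_skip (j0 := b)) ?in_setC ?iA ?porbit_id.
by rewrite [in X in _ \in porbit _ (s X)]prv_pred ?in_setC ?iA ?porbit_id.
Qed.

Lemma hub_psi i : hub (psi i) \in porbit phi (hub i).
Proof.
by rewrite -next_spoke_face_hub face_step // hub_reach ?hubless_face.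
Qed.

Lemma face_count_proper : A != set0 -> A != setT -> face_count (wheel_rot A s) = ncyc psi.
Proof.
move=> A0 AT; have alive d : ~~ hubless d.
  by case: (dartP d) => i; rewrite ?hubless_rgt ?hubless_lft.
apply: (card_porbits_transfer (h := hub) (p := next_spoke)) => [d|i|d|i].
- by rewrite next_spoke_face.
- exact: hub_psi.
- exact: hub_reach.
by rewrite next_spoke_hub porbit_id.
Qed.

(** The face that avoids the hub is matched with an additional fixed point of the
    permutation of the spokes. *)
Lemma face_count_trivial :
  (A == set0) || (A == setT) -> face_count (wheel_rot A s) = (ncyc psi).+1.
Proof.
move=> A0T; rewrite -card_porbits_lift0.
pose h (x : 'I_n.+1) : dart (wheel n) :=
  if unlift 0 x is Some i then hub i else if A == set0 then rgt ord0 else lft ord0.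
pose p d : 'I_n.+1 := if hubless d then 0 else lift 0 (next_spoke d).
have h0 : h 0 = if A == set0 then rgt ord0 else lft ord0 by rewrite /h unlift_none.
have hl i : h (lift 0 i) = hub i by rewrite /h liftK.
have A0Tn : A == set0 -> A == setT -> False.
  by move=> /eqP -> /eqP/setP/(_ ord0); rewrite !inE.
apply: (card_porbits_transfer (h := h) (p := p)) => [d|x|d|x].
- rewrite /p hubless_face; case: ifPn => [_|live]; first exact: porbit_id.
  by rewrite porbit_lift0 imset_f // next_spoke_face.
- case: (unliftP 0 x) => [i|] ->; last by rewrite lift0_perm0 porbit_id.
  by rewrite lift0_perm_lift !hl hub_psi.
- rewrite /p; case: ifPn => [dead|live]; last by rewrite hl hub_reach.
  rewrite h0; case: (dartP d) dead => // i; rewrite ?hubless_rgt ?hubless_lft => dead.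
    by rewrite dead rgt_loop //; exact/eqP.
  case: ifP => [A0|_]; first by case: (A0Tn A0 dead).
  by rewrite lft_loop //; exact/eqP.
case: (unliftP 0 x) => [i|] ->; rewrite /p ?hl ?porbit_id //.
rewrite h0; move: A0T; case: (boolP (A == set0)) => [A0 _|_ /= AT];
  rewrite ?hubless_rgt ?hubless_lft.
  by rewrite A0 porbit_id.
by rewrite AT porbit_id.
Qed.

End Faces.

Lemma card_edges_wheel : #|edges (wheel n)| = (2 * n)%N.
Proof.
pose spoke i : {set option 'I_n} := [set None; Some i].
pose rim_edge i : {set option 'I_n} := [set Some i; Some (ordS i)].
have edgesE : edges (wheel n) = (spoke @: 'I_n) :|: (rim_edge @: 'I_n).
  apply/setP=> e; rewrite inE; apply/imsetP/orP => [[d dG ->]|].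
    rewrite inE in dG; pose dd : dart (wheel n) := exist _ d dG.
    rewrite -[d]/(val dd); case: (dartP dd) => i /=.
    - by left; exact: imset_f.
    - by left; rewrite setUC; exact: imset_f.
    - by right; exact: imset_f.
    by right; apply/imsetP; exists (ord_pred i); rewrite // /rim_edge ord_predK setUC.
  case=> /imsetP[i _ ->]; first by exists (None, Some i); rewrite ?inE.
  by exists (Some i, Some (ordS i)); rewrite // inE; exact: rgt_subproof.
have spoke_inj : injective spoke.
  by move=> i j /setP/(_ (Some i)); rewrite !inE eqxx /= => /esym/eqP[].
have rim_edge_inj : injective rim_edge.
  move=> i j /setP e; have := e (Some i); have := e (Some (ordS i)).
  rewrite !inE !eqxx orbT => /esym/orP[]/eqP/Some_inj Si /esym/orP[]/eqP/Some_inj ij //.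
    by have := ordS_neq_pred j; rewrite -ij -Si ordSK eqxx.
  by rewrite -[i]ordSK Si ordSK.
rewrite edgesE cardsU (card_imset _ spoke_inj) (card_imset _ rim_edge_inj) card_ord.
rewrite (_ : _ :&: _ = set0) ?cards0 ?subn0 ?mul2n ?addnn //.
apply/setP=> e; rewrite !inE; apply/andP=> -[/imsetP[i _ ->] /imsetP[j _]].
by move=> /setP/(_ None); rewrite !inE.
Qed.

End WheelDarts.

(** * From rotation systems to the genus polynomial *)

Lemma porbit_rim n (A : {set 'I_n}) i :
  porbit (rim A) i = if i \in A then A else ~: A.
Proof.
case: ifPn => iA.
  case: (rim_top iA) => x xA [_ px].
  by rewrite -[RHS]px; apply/eqP; rewrite eq_porbit_mem px.
case: (rim_bottom iA) => x xA [_ px].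
by rewrite -[RHS]px; apply/eqP; rewrite eq_porbit_mem px in_setC.
Qed.

Lemma card_porbits_rim n (A : {set 'I_n.+1}) :
  ncyc (rim A) = (~~ ((A == set0) || (A == setT))).+1.
Proof.
have [/eqP A0|A0] := eqVneq A set0.
  suff -> : porbits (rim A) = [set setT] by rewrite cards1.
  apply/setP=> O; rewrite in_set1 (eqP A0); apply/imsetP/eqP => [[i _ ->]|->].
    by rewrite porbit_rim inE setC0.
  by exists ord0; rewrite // porbit_rim inE setC0.
have [/eqP AT|AT] := eqVneq A setT.
  suff -> : porbits (rim A) = [set setT] by rewrite cards1 orbT.
  apply/setP=> O; rewrite in_set1 (eqP AT); apply/imsetP/eqP => [[i _ ->]|->].
    by rewrite porbit_rim inE.
  by exists ord0; rewrite // porbit_rim inE.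
case/set0Pn: A0 => a aA; have [b bA] := outside_ex AT.
suff -> : porbits (rim A) = [set A; ~: A].
  rewrite cards2 (_ : A != ~: A) //; apply/eqP=> /setP/(_ a).
  by rewrite in_setC aA.
apply/setP=> O; rewrite in_set2; apply/imsetP/orP => [[i _ ->]|[]/eqP->].
- by rewrite porbit_rim; case: ifP; rewrite eqxx; [left | right].
- by exists a; rewrite // porbit_rim aA.
by exists b; rewrite // porbit_rim (negPf bA).
Qed.

(** The number of cycles of a permutation has the parity of the number of points
    plus that of the permutation, and rim A and s have known cycle counts. *)
Lemma wheel_euler n' (A : {set 'I_n'.+3}) s : ncyc s == 1%N ->
  exists k, (face_count (wheel_rot A s) + k.*2 = n'.+4)%N.
Proof.
move=> s1; have : odd_perm (rim A * s)%g = odd_perm (rim A) (+) odd_perm s.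
  by rewrite odd_permM.
rewrite /odd_perm card_ord (eqP s1) card_porbits_rim => par.
have le_n : (ncyc (rim A * s)%g <= n'.+3)%N.
  by rewrite (leq_trans (leq_imset_card _ _)) ?card_ord.
suff [F_le F_odd] : (face_count (wheel_rot A s) <= n'.+4)%N /\
    odd (face_count (wheel_rot A s)) = odd n'.
  exists (n'.+4 - face_count (wheel_rot A s))./2.
  by rewrite even_halfK ?subnKC // oddB //= F_odd !negbK addbb.
case triv: ((A == set0) || (A == setT)).
  rewrite face_count_trivial // ltnS; split=> //.
  by move: par; rewrite triv /=; case: (odd n'); case: (odd _).
move: (triv) => /norP[A0 AT]; rewrite face_count_proper //; split; first exact: leqW.
by move: par; rewrite triv /=; case: (odd n'); case: (odd _).
Qed.

Lemma sum_rotation (V : nmodType) n' (G : {perm dart (wheel n'.+3)} -> V) :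
  \sum_(rho | rotation_system rho) G rho =
  \sum_(A : {set 'I_n'.+3}) \sum_(s : 'S_n'.+3 | ncyc s == 1%N) G (wheel_rot A s).
Proof.
rewrite pair_big /= -[RHS](big_imset G (h := fun p => wheel_rot p.1 p.2)
  (A := [pred p | ncyc p.2 == 1%N])) /=.
  apply: eq_bigl => rho; apply/idP/imsetP => [/rotation_rotP[A [s s1 ->]]|[[A s] s1 ->]].
    by exists (A, s).
  exact: rotation_rot.
by move=> [A s] [A' s'] _ _ /= /wheel_rot_inj[-> ->].
Qed.

Lemma genus_poly_wheel (R : fieldType) n' (r : R) : r != 0 ->
  (genus_poly (wheel n'.+3) R).[r ^+ 2] =
  r ^+ n'.+4 * \sum_(A : {set 'I_n'.+3}) \sum_(s : 'S_n'.+3 | ncyc s == 1%N)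
     r^-1 ^+ face_count (wheel_rot A s).
Proof.
move=> r0; rewrite -(sum_rotation (fun rho => r^-1 ^+ face_count rho)).
pose G := wheel n'.+3; pose euler (rho : {perm dart G}) (k : nat) :=
  #|{: option 'I_n'.+3}|%:Z - #|edges G|%:Z + (face_count rho)%:Z == 2 - 2 * k%:Z.
have gc k : (genus_count G k)%:R = \sum_(rho | rotation_system rho) (euler rho k)%:R :> R.
  rewrite /genus_count -sum1_card natr_sum.
  rewrite (eq_bigl (fun rho => rotation_system rho && euler rho k)).
    by rewrite big_mkcondr; apply: eq_bigr => rho _; case: (euler rho k).
  by move=> rho; rewrite inE.
rewrite horner_poly mulr_sumr; under eq_bigr => k _ do rewrite gc mulr_suml.
rewrite exchange_big /=; apply: eq_bigr => rho /rotation_rotP[A [s s1 ->]].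
have [k0 Fk0] := wheel_euler A s1.
have eulerE k : euler (wheel_rot A s) k = (k == k0).
  rewrite /euler card_option card_ord card_edges_wheel.
  by apply/eqP/eqP; move: (face_count _) Fk0 => F; lia.
have k0_lt : (k0 < #|edges G|.+1)%N by rewrite card_edges_wheel; lia.
rewrite (bigD1 (Ordinal k0_lt)) //= eulerE eqxx mul1r big1 ?addr0 => [|k kk0].
  rewrite -Fk0 exprD mulrAC exprVn divff ?expf_neq0 // mul1r -muln2 mulnC.
  by rewrite exprM.
by rewrite eulerE -val_eqE in kk0 *; rewrite (negPf kk0) mul0r.
Qed.

Lemma rising_opp (R : comPzRingType) (z : R) n :
  rising z n = (-1) ^+ n * rising (1 - n%:R - z) n.
Proof.
rewrite /rising (reindex_inj rev_ord_inj) /= -[n in (-1) ^+ n]card_ord.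
rewrite -prodr_const -big_split.
apply: eq_bigr => i _ /=; rewrite natrB // -natr1; ring.
Qed.

Lemma sum_even (V : nmodType) n (g : nat -> V) :
  \sum_(0 <= j < n.+1 | ~~ odd j) g j = \sum_(0 <= m < n./2.+1) g m.*2.
Proof.
elim: n => [|n IHn]; first by rewrite big_mkcond !big_nat1.
rewrite big_mkcond big_nat_recr //= -big_mkcond IHn uphalf_half.
case: (boolP (odd n)) => on /=; last by rewrite addr0.
rewrite add1n [RHS]big_nat_recr //=; congr (_ + g _).
by rewrite doubleS -[in LHS](odd_double_half n) on.
Qed.

(** Up to the sign (-1)^(n + 1), rising (y - n) (n + 1) is rising (- y) (n + 1), so
    the difference keeps every other Stirling number. *)
Lemma rising_diff (R : comPzRingType) (y : R) n :
  rising y n.+1 - rising (y - n%:R) n.+1 =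
  2 * \sum_(0 <= m < n./2.+1) (stirling1 n.+1 (n - 2 * m))%:R * y ^+ (n - 2 * m).
Proof.
rewrite [rising (y - _) _]rising_opp (_ : 1 - _ - _ = - y); last by rewrite -natr1; ring.
rewrite -!sum_stirling1 [X in _ - X = _]mulr_sumr -sumrB.
rewrite (eq_bigr (fun k : 'I_n.+2 =>
  (stirling1 n.+1 k)%:R * y ^+ k * (1 - (-1) ^+ (n.+1 + k)))) => [|k _]; last first.
  by rewrite (exprNn y) exprD; move: (stirling1 _ _) => c; ring.
rewrite big_ord_recr /= addnn -muln2 exprM sqrr_sign subrr mulr0 addr0.
rewrite (reindex_inj rev_ord_inj) /=.
rewrite -(big_mkord predT (fun j => (stirling1 n.+1 (n.+1 - j.+1))%:R * y ^+ (n.+1 - j.+1)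
  * (1 - (-1) ^+ (n.+1 + (n.+1 - j.+1))))).
rewrite big_nat_cond.
rewrite (eq_bigr (fun j => if ~~ odd j
  then 2 * ((stirling1 n.+1 (n - j))%:R * y ^+ (n - j)) else 0)).
  rewrite -big_nat_cond -big_mkcond /= sum_even mulr_sumr.
  by apply: eq_bigr => m _; rewrite -mul2n.
move=> j /andP[/andP[_ jn] _]; rewrite subSS.
have -> : (-1) ^+ (n.+1 + (n - j)) = - (-1) ^+ j :> R.
  rewrite -signr_odd oddD oddB // -[in RHS]signr_odd /=.
  by case: (odd n); case: (odd j); rewrite /= ?expr0 ?expr1 ?opprK.
rewrite -signr_odd; case: (odd j); rewrite /= ?expr0 ?expr1; last by ring.
by rewrite opprK subrr mulr0.
Qed.

(** These are the c_k, with k = m - 1, in a form that obeys a first-order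
    recurrence in m. *)
Definition binom_defect n m : int := 2 ^+ n.-1 - \sum_(j < m) 'C(n, j)%:Z.

Lemma sum_bin n : \sum_(j < n.+1) 'C(n, j)%:Z = 2 ^+ n.
Proof.
by rewrite -[2]/(1 + 1) exprDn; apply: eq_bigr => j _; rewrite !expr1n mul1r natz.
Qed.

Lemma signed_sumE a b u :
  signed_sum a b u = \sum_(j < b.+1) u j - \sum_(j < a) u j.
Proof.
rewrite /signed_sum -!(big_mkord predT u); case: ltnP => ab.
  by rewrite (big_cat_nat (leq0n b.+1) ab) /= opprD addrA subrr add0r.
by rewrite (big_cat_nat (leq0n a) (leqW ab)) /= addrC addrK.
Qed.

Lemma sum_bin_rev n k : (k <= n.+1)%N ->
  \sum_(j < n.+1 - k) 'C(n, j)%:Z = 2 ^+ n - \sum_(j < k) 'C(n, j)%:Z.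
Proof.
elim: k => [|k IHk] kn; first by rewrite subn0 sum_bin big_ord0 subr0.
have := IHk (ltnW kn); rewrite (subSn (ltnSE kn)) !big_ord_recr /= bin_sub // subSS.
by move=> e; rewrite opprD addrA -e addrK.
Qed.

Lemma sum_binS n k : \sum_(j < k.+1) 'C(n.+1, j)%:Z =
  \sum_(j < k.+1) 'C(n, j)%:Z + \sum_(j < k) 'C(n, j)%:Z.
Proof.
elim: k => [|k IHk]; first by rewrite !big_ord1 big_ord0 !bin0.
rewrite big_ord_recr /= IHk [\sum_(j < k.+2) _]big_ord_recr.
rewrite [X in _ = _ + X]big_ord_recr /=.
by rewrite binS PoszD; ring.
Qed.

Lemma wheel_coefE n k : (1 < n)%N -> (k < n)%N -> wheel_coef n k = binom_defect n k.+1.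
Proof.
case: n => [|n] // n1 kn; rewrite /wheel_coef /binom_defect /=.
case: eqP => [->|_]; first by rewrite big_ord1 bin0.
case: eqP => [->|_].
  have := sum_bin n.+1; rewrite big_ord_recr /= binn exprS.
  by move=> /(canRL (addrK _)) ->; ring.
rewrite signed_sumE -subSn // sum_bin_rev 1?ltnW // sum_binS; ring.
Qed.

Lemma binom_defect_poly (R : comNzRingType) n m :
  (1 - 'X) * \sum_(k < m) (binom_defect n k.+1)%:~R * 'X^k =
  2 ^+ n.-1 - \sum_(k < m) 'C(n, k)%:R * 'X^k - (binom_defect n m)%:~R * 'X^m :> {poly R}.
Proof.
elim: m => [|m IHm].
  rewrite !big_ord0 mulr0 /binom_defect big_ord0 !subr0 expr0 mulr1 rmorphXn /=.
  by rewrite subrr.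
have DS : binom_defect n m = binom_defect n m.+1 + 'C(n, m)%:Z.
  by rewrite /binom_defect big_ord_recr /= opprD addrA subrK.
rewrite big_ord_recr mulrDr IHm [in RHS]big_ord_recr /= DS intrD -pmulrn exprS.
move: (\sum_(_ < _) _) => S; ring.
Qed.

(** The left-hand side is 2^n (1 + X^n) - 2 (1 + X)^n, by the binomial theorem. *)
Lemma sum_rchar_blocks (R : comNzRingType) n : (1 < n)%N ->
  \sum_(a < n.+1) 'C(n, a)%:R * ((1 - 'X^a) * (1 - 'X^(n - a))) =
  (1 - 'X) * (2 * \sum_(k < n) (wheel_coef n k)%:~R * 'X^k) :> {poly R}.
Proof.
move=> n1; under [in RHS]eq_bigr => k _ do rewrite (wheel_coefE n1 (ltn_ord k)).
rewrite mulrCA binom_defect_poly.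
have binom_sum : \sum_(a < n.+1) 'C(n, a)%:R * 'X^a = (1 + 'X) ^+ n :> {poly R}.
  by rewrite exprDn; apply: eq_bigr => a _; rewrite expr1n mul1r mulr_natl.
have binom_sum_rev : \sum_(a < n.+1) 'C(n, a)%:R * 'X^(n - a) = (1 + 'X) ^+ n :> {poly R}.
  rewrite addrC exprDn; apply: eq_bigr => a _.
  by rewrite expr1n mulr1 mulr_natl.
have bins : \sum_(a < n.+1) 'C(n, a)%:R = 2 ^+ n :> {poly R}.
  rewrite -natrX -[(2 ^ n)%N]/((1 + 1) ^ n)%N expnDn natr_sum.
  by apply: eq_bigr => a _; rewrite !exp1n !muln1.
transitivity (2 ^+ n * (1 + 'X^n) - 2 * (1 + 'X) ^+ n : {poly R}).
  rewrite -bins mulr_suml [in RHS]mulr2n mulrDl mul1r.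
  rewrite -{1}binom_sum -binom_sum_rev -big_split -sumrB.
  apply: eq_bigr => a _; have an : (a <= n)%N by rewrite -ltnS.
  have -> : 'X^n = 'X^a * 'X^(n - a) :> {poly R} by rewrite -exprD subnKC.
  by move: (_%:R : {poly R}) => c /=; ring.
have bdn : (binom_defect n n)%:~R = 1 - 2 ^+ n.-1 :> {poly R}.
  have -> : binom_defect n n = 1 - 2 ^+ n.-1.
    have := sum_bin n; rewrite big_ord_recr /= binn => /(canRL (addrK _)).
    rewrite /binom_defect => ->; case: (n) n1 => // m _; rewrite exprS /=; ring.
  by rewrite rmorphB rmorph1 rmorphXn.
have := binom_sum; rewrite big_ord_recr /= binn mul1r => /(canRL (addrK _)) ->.
rewrite bdn; case: (n) n1 => // m _; rewrite [2 ^+ m.+1]exprS /=; ring.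
Qed.

Lemma shift_rising_intl (R : comNzRingType) (y : R) n c (q : {poly R}) :
  shift_rising y n (c%:~R * q) = c%:~R * shift_rising y n q.
Proof. by rewrite mulrzl raddfMz /= mulrzl. Qed.

Lemma sum_by_card (V : nmodType) n (g : nat -> V) :
  \sum_(A : {set 'I_n}) g #|A| = \sum_(a < n.+1) g a *+ 'C(n, a).
Proof.
have card_lt (A : {set 'I_n}) : (#|A| < n.+1)%N.
  by rewrite ltnS -[n in (_ <= n)%N]card_ord max_card.
rewrite (partition_big (fun A => Ordinal (card_lt A)) predT) //=; apply: eq_bigr => a _.
rewrite (eq_bigr (fun=> g a)) => [|A /eqP <-] //.
rewrite sumr_const -[n in 'C(n, _)]card_ord -card_draws; congr (_ *+ _).
by apply: eq_card => A; rewrite !inE.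
Qed.

(** By [cycle_sum_rchar] the sum over s depends on #|A| only; the term of A = set0
    or setT carries an extra factor y, for the face that avoids the hub. *)
Lemma wheel_cycle_sums (R : numDomainType) (y : R) n' (n := n'.+3) :
  n%:R * n.+1%:R *
    (\sum_(A : {set 'I_n}) \sum_(s : 'S_n | ncyc s == 1%N)
        y ^+ face_count (wheel_rot A s)) =
  4 * y * \sum_(0 <= m < n./2.+1) (stirling1 n.+1 (n - 2 * m))%:R * y ^+ (n - 2 * m)
  + 2 * n.+1%:R * \sum_(0 <= k < n) (wheel_coef n k)%:~R * rising (y - k%:R) n.
Proof.
pose L q := shift_rising y n.+1 (q : {poly R}).
(* [block a] also makes sense for the trivial sets, where it vanishes. *)
pose block a := (1 - 'X^a) * (1 - 'X^(n - a)) : {poly R}.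
pose ends a := ((a == 0%N) || (a == n))%:R : R.
have inner (A : {set 'I_n}) :
    n%:R * n.+1%:R * (\sum_(s : 'S_n | ncyc s == 1%N) y ^+ face_count (wheel_rot A s)) =
    L (block #|A|) + ends #|A| * (y * L (1 - 'X^n)).
  have endsE : ends #|A| = ((A == set0) || (A == setT))%:R.
    rewrite /ends cards_eq0; congr (_ || _)%:R.
    rewrite [A == setT]eqEcard subsetT cardsT card_ord eqn_leq.
    by rewrite -[X in (_ <= X)%N](card_ord n) max_card.
  case triv: ((A == set0) || (A == setT)); rewrite endsE triv.
    rewrite (eq_bigr (fun s => y * y ^+ ncyc (rim A * s)%g)) => [|s _]; last first.
      by rewrite face_count_trivial // exprS.
    rewrite -mulr_sumr -/(cycle_sum y (rim A)) mulrCA cycle_sum_rchar.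
    rewrite rchar_rim // triv mul1r.
    suff -> : block #|A| = 0 by rewrite /L linear0 add0r.
    case/orP: triv => /eqP ->;
      rewrite /block ?cards0 ?cardsT ?card_ord ?subnn expr0 subrr.
      by rewrite mul0r.
    by rewrite mulr0.
  rewrite (eq_bigr (fun s => y ^+ ncyc (rim A * s)%g)) => [|s _]; last first.
    by move/norP: triv => [A0 AT]; rewrite face_count_proper.
  by rewrite -/(cycle_sum y (rim A)) cycle_sum_rchar rchar_rim // triv mul0r addr0.
rewrite [LHS]mulr_sumr; under eq_bigr => A _ do rewrite inner.
rewrite (sum_by_card n (fun a => L (block a) + ends a * (y * L (1 - 'X^n)))).
under eq_bigr => a _ do rewrite mulrnDl.
rewrite big_split /= addrC; congr (_ + _).
  have LXn : L (1 - 'X^n) = rising y n.+1 - rising (y - n%:R) n.+1.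
    by rewrite /L linearB /= -(expr0 'X) !shift_risingXn subr0.
  rewrite LXn rising_diff; move: (\sum_(_ <= _ < _) _) => S.
  rewrite big_ord_recl big_ord_recr /= big1 ?add0r => [|a _]; last first.
    by rewrite /ends /bump add1n /= (ltn_eqF (ltn_ord a : (a.+1 < n)%N)) ?mul0r ?mul0rn.
  by rewrite /ends /= ?eqxx ?orbT bin0 binn !mulr1n !mul1r; ring.
rewrite (eq_bigr (fun a : 'I_n.+1 => L ('C(n, a)%:R * block a))) => [|a _]; last first.
  by rewrite /L shift_rising_natl mulr_natl.
rewrite -linear_sum /= sum_rchar_blocks //.
rewrite /L shift_rising_diff shift_rising_natl linear_sum /=.
rewrite big_mkord mulrA [n.+1%:R * 2]mulrC; congr (_ * _).
by apply: eq_bigr => k _; rewrite shift_rising_intl shift_risingXn.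
Qed.

Theorem theorem1p5 (R : realType) (n : nat) (hn : (3 <= n)%N)
    (x : R) (hx : 0 < x) :
  (genus_poly (wheel n) R).[x] =
    4 / (n%:R * (n%:R + 1))
      * (\sum_(0 <= m < n./2.+1) (stirling1 n.+1 (n - 2 * m))%:R * x ^+ m)
    + 2 * (-1) ^+ n / n%:R * Num.sqrt x ^+ n.+1
      * (\sum_(0 <= k < n) (wheel_coef n k)%:~R
           * rising (k%:R - n%:R + 1 - 1 / Num.sqrt x) n).
Proof.
case: n hn => [|[|[|n]]] // _; set r := Num.sqrt x.
have r0 : r != 0 by rewrite gt_eqF // sqrtr_gt0.
have xr : x = r ^+ 2 by rewrite sqr_sqrtr // ltW.
rewrite [in LHS]xr genus_poly_wheel //.
have N0 k : k.+1%:R != 0 :> R by rewrite pnatr_eq0.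
have nn0 : n.+3%:R * n.+4%:R != 0 :> R by rewrite mulf_neq0.
set S := \sum_(0 <= m < _) _; set C := \sum_(0 <= k < _) _.
pose S1 : R := \sum_(0 <= m < n.+3./2.+1)
  (stirling1 n.+4 (n.+3 - 2 * m))%:R * r^-1 ^+ (n.+3 - 2 * m).
have S1E : r ^+ n.+4 * (r^-1 * S1) = S.
  rewrite 2!mulr_sumr /S big_nat_cond [RHS]big_nat_cond.
  apply: eq_bigr => m /andP[/andP[_ mn] _].
  have [e en] : exists e, (n.+3 = e + 2 * m)%N.
    by exists (n.+3 - 2 * m)%N; have := odd_double_half n.+3; lia.
  rewrite xr -exprM [in LHS](_ : n.+3 - 2 * m = e)%N; last by lia.
  rewrite (_ : n.+4 = e.+1 + 2 * m)%N; last by lia.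
  rewrite (_ : n.+3 - 2 * m = e)%N; last by lia.
  by rewrite exprD exprS exprVn; move: (stirling1 _ _) => c; field; rewrite r0 expf_neq0.
have CE : \sum_(0 <= k < n.+3) (wheel_coef n.+3 k)%:~R
    * rising (r^-1 - k%:R) n.+3 = (-1) ^+ n.+3 * C.
  rewrite mulr_sumr; apply: eq_bigr => k _; rewrite rising_opp mulrCA.
  by congr (_ * (_ * rising _ _)); rewrite div1r; ring.
apply: (mulfI nn0); rewrite mulrCA wheel_cycle_sums -/S1 CE -S1E.
rewrite -[n.+4%:R]natr1; have := N0 n.+2; have := N0 n.+3; rewrite -[n.+4%:R]natr1.
move: (n.+3%:R) ((-1) ^+ n.+3) => N sg N1 N2.
clear CE S1E; clearbody S1 C; move: (r ^+ n.+4) => rn.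
by field; rewrite N1 N2 r0.
Qed.
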